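(* Let $X$ be a proper LQC space, $\kappa$ a sublinear function and $q$ a quasi-geodesic ray in $X$. The following are equivalent: (1) $q$ is $\kappa$-Morse. (2) $q$ is $\kappa$-contracting. (3) $q$ is weakly $\kappa$-Morse.
   Context: **Sublinear Morseness.** $(X,d)$ is a proper geodesic metric space with a fixed basepoint $\mathfrak o$; write $\|x\|=d(x,\mathfrak o)$. A sublinear function is a concave, monotone (non-decreasing) function $\kappa:[0,\infty)\to[1,\infty)$ with $\lim_{t\to\infty}\kappa(t)/t=0$; for a point $x$, $\kappa(x)=\kappa(\|x\|)$. All quasi-geodesics are continuous; quasi-geodesic rays start at $\mathfrak o$. For closed $Z$, $\mathcal N_\kappa(Z,n)=\{x: d(x,Z)\le n\,\kappa(x)\}$. For a quasi-geodesic ray $\beta$ and $r\ge0$ let $t_r$ be the first time with $\|\beta(t_r)\|=r$; $\beta_r=\beta(t_r)$, $\beta|_r=\beta([0,t_r])$. $D$ is small compared to $r$ if $D\le r/(2\kappa(r))$. A closed set $Z$ is - weakly $\kappa$-Morse if there is $\mathsf m_Z:\mathbb R^+\times\mathbb R^+\to\mathbb R^+$ such that every $(\mathsf q,\mathsf Q)$-quasi-geodesic $\beta$ with endpoints on $Z$ satisfies $\beta\subset\mathcal N_\kappa(Z,\mathsf m_Z(\mathsf q,\mathsf Q))$; - $\kappa$-Morse if there is a proper function $\mathsf m_Z:\mathbb R^+\times\mathbb R^+\to\mathbb R^+$ such that for every sublinear $\kappa'$ and every $r>0$ there is $R\ge r$ such that for every $(\mathsf q,\mathsf Q)$-quasi-geodesic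 ray $\beta$ with $\beta(0)=\mathfrak o$ and $\mathsf m_Z(\mathsf q,\mathsf Q)$ small compared to $r$: $d(\beta_R,Z)\le\kappa'(R)\Rightarrow\beta|_r\subseteq\mathcal N_\kappa(Z,\mathsf m_Z(\mathsf q,\mathsf Q))$; - $\kappa$-contracting if there are a map $\pi_Z:X\to\mathcal P(Z)$ (subsets of $Z$) and constants $D_1,D_2,C_1,C_2$ depending only on $Z,\kappa$ with $\mathrm{diam}(\{x\}\cup\pi_Z(x))\le(D_1+1)d(x,Z)+D_2\kappa(x)$ for all $x\in X$, and $d(x,y)<C_1d(x,Z)\Rightarrow\mathrm{diam}(\pi_Z(x)\cup\pi_Z(y))\le C_2\kappa(x)$ for all $x,y\in X$. **LQC spaces.** $(X,d)$ is a coarse median space if there are $m=m_X:X^3\to X$ and $\mathsf h:\mathbb N\to\mathbb N$ such that (i) $d(m(x,y,z),m(x',y',z'))\le \mathsf h(1)(d(x,x')+d(y,y')+d(z,z'))$; (ii) for each $n$ and each $A\subseteq X$ with $|A|\le n$ there are a finite CAT(0) cube complex $Q$ and maps $f:Q\to X$, $g:A\to Q$ with $d(f(m_Q(a,b,c)),m_X(f(a),f(b),f(c)))\le \mathsf h(n)$ and $d(a,f(g(a)))\le \mathsf h(n)$. It has rank $v$ if these $Q$ can be chosen of dimension at most $v$. In a CAT(0) cube complex the median of three vertices is the unique vertex lying on combinatorial geodesics between each pair. Put $[x,y]=\{m(x,y,z):z\in X\}$, $J(A)=\bigcup_{x,y\in A}[x,y]$, $\mathrm{hull}_X(A)=J^v(A)$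 in rank $v$. A map is $K$-median if it preserves medians up to additive error $K$. $X$ is locally quasi-cubical (LQC) if it is a coarse median space and there is a positive integer $v$ such that for each finite $F\subseteq X$ there are $K=K(|F|)$, a CAT(0) cube complex $Q$ of dimension $v$, and a $K$-median $(K,K)$-quasi-isometry $Q\to\mathrm{hull}_X(F)$. *)

(* Defs.v *)
From HB Require Import structures.
From mathcomp Require Import all_boot all_order all_algebra finmap.
From mathcomp Require Import all_classical all_reals all_analysis.

Set Implicit Arguments.
Unset Strict Implicit.
Unset Printing Implicit Defensive.

Import Order.TTheory GRing.Theory Num.Theory.
Import numFieldNormedType.Exports.

Local Open Scope classical_set_scope.
Local Open Scope ring_scope.

Section DistanceSpaces.
Context {R : realType}.

Definition eucl_dist n (x y : 'rV[R]_n) : R :=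
  Num.sqrt (\sum_(i < n) (x ord0 i - y ord0 i) ^+ 2).

Definition geodesic (T : Type) (d : T -> T -> R) (p q : T) (g : R -> T) : Prop :=
  [/\ g 0 = p, g (d p q) = q &
      forall s t, 0 <= s <= d p q -> 0 <= t <= d p q -> d (g s) (g t) = `|s - t|].

Definition geodesic_space (T : Type) (d : T -> T -> R) : Prop :=
  forall p q, exists g, geodesic d p q g.

(* Any two points of a geodesic triangle lie on two sides [p, q], [p, r] issuing
   from a common vertex p (up to renaming the vertices); a, b, c is a comparison
   triangle in the Euclidean plane. *)
Definition CAT0_inequality (T : Type) (d : T -> T -> R) : Prop :=
  forall (p q r : T) (g g' : R -> T) (a b c : 'rV[R]_2) (s t : R),
    geodesic d p q g -> geodesic d p r g' ->
    eucl_dist a b = d p q -> eucl_dist a c = d p r -> eucl_dist b c = d q r ->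
    0 <= s <= 1 -> 0 <= t <= 1 ->
    d (g (s * d p q)) (g' (t * d p r)) <=
      eucl_dist (a + s *: (b - a)) (a + t *: (c - a)).

End DistanceSpaces.

Section CubeComplexes.
Context {R : realType}.

Definition unit_cube n : set 'rV[R]_n := [set x | forall i, 0 <= x ord0 i <= 1].

Definition cube_corner n : set 'rV[R]_n :=
  [set x | forall i, x ord0 i = 0 \/ x ord0 i = 1].

(* phi i = Some b fixes the i-th coordinate to b; phi i = None leaves it free. *)
Definition cube_face n (phi : 'I_n -> option bool) : set 'rV[R]_n :=
  [set x | unit_cube x /\ forall i (b : bool), phi i = Some b -> x ord0 i = b%:R].

End CubeComplexes.

(* A cubical complex in the sense of Bridson and Haefliger (Definition I.7.32):
   a set covered by injectively embedded unit cubes, any two of which that meet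
   do so along a face of each, the identification being an isometry of faces.
   The values of cc_map outside the unit cube are irrelevant. *)
Record cube_complex (R : realType) := CubeComplex {
  cc_point :> Type;
  cc_cube : Type;
  cc_dim : cc_cube -> nat;
  cc_map : forall c : cc_cube, 'rV[R]_(cc_dim c) -> cc_point;
  cc_cover : forall p, exists c x, unit_cube x /\ cc_map (c := c) x = p;
  cc_inj : forall c x y, unit_cube x -> unit_cube y ->
    cc_map (c := c) x = cc_map y -> x = y;
  cc_glue : forall c c',
    (exists x y, [/\ unit_cube x, unit_cube y & cc_map (c := c) x = cc_map (c := c') y]) ->
    exists (phi : 'I_(cc_dim c) -> option bool) (phi' : 'I_(cc_dim c') -> option bool)
           (h : 'rV[R]_(cc_dim c) -> 'rV[R]_(cc_dim c')),
      [/\ h @` cube_face phi = cube_face phi',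
          forall x y, cube_face phi x -> cube_face phi y ->
            eucl_dist (h x) (h y) = eucl_dist x y &
          forall x y, unit_cube x -> unit_cube y ->
            (cc_map (c := c) x = cc_map (c := c') y <-> cube_face phi x /\ y = h x)]
}.

Section CubeComplexTheory.
Context {R : realType} (Q : cube_complex R).

(* cc_string p q l: a string of points from p to q, consecutive points lying in
   a common cube, of total length l. *)
Inductive cc_string : Q -> Q -> R -> Prop :=
| cc_string_nil p : cc_string p p 0
| cc_string_cons (c : cc_cube Q) (x y : 'rV[R]_(cc_dim c)) (q : Q) (l : R) :
    unit_cube x -> unit_cube y -> cc_string (cc_map y) q l ->
    cc_string (cc_map x) q (eucl_dist x y + l).

Definition cc_dist (p q : Q) : R := inf [set l | cc_string p q l].

(* The first clause ensures that cc_dist is the infimum of a nonempty set, the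
   second that this pseudometric is a metric. *)
Definition CAT0_cube_complex : Prop :=
  [/\ forall p q, exists l, cc_string p q l,
      forall p q, cc_dist p q = 0 -> p = q,
      geodesic_space cc_dist &
      CAT0_inequality cc_dist].

Definition cc_finite : Prop := finite_set [set: cc_cube Q].

Definition cc_dim_le (v : nat) : Prop := forall c : cc_cube Q, (cc_dim c <= v)%N.

Definition cc_dim_eq (v : nat) : Prop :=
  cc_dim_le v /\ exists c : cc_cube Q, cc_dim c = v.

Definition cc_vertex : set Q :=
  [set p | exists (c : cc_cube Q) (x : 'rV[R]_(cc_dim c)), cube_corner x /\ cc_map x = p].

Definition cc_adjacent (p q : Q) : Prop :=
  exists (c : cc_cube Q) (x y : 'rV[R]_(cc_dim c)),
    [/\ cube_corner x, cube_corner y, #|[set i | x ord0 i != y ord0 i]%SET| = 1%N,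
        cc_map x = p & cc_map y = q].

Definition edge_path (a b : Q) (n : nat) (w : nat -> Q) : Prop :=
  [/\ w 0%N = a, w n = b & forall i, (i < n)%N -> cc_adjacent (w i) (w i.+1)].

Definition comb_geodesic (a b : Q) (n : nat) (w : nat -> Q) : Prop :=
  edge_path a b n w /\ forall n' w', edge_path a b n' w' -> (n <= n')%N.

Definition on_comb_geodesic (a b p : Q) : Prop :=
  exists n w i, [/\ comb_geodesic a b n w, (i <= n)%N & w i = p].

Definition comb_dist (a b : Q) (n : nat) : Prop := exists w, comb_geodesic a b n w.

(* On vertices, mQ a b c is the unique vertex lying on combinatorial geodesics
   between each pair; elsewhere mQ is unconstrained. *)
Definition cc_median (mQ : Q -> Q -> Q -> Q) : Prop :=
  forall a b c, cc_vertex a -> cc_vertex b -> cc_vertex c ->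
    forall p, p = mQ a b c <->
      [/\ cc_vertex p, on_comb_geodesic a b p, on_comb_geodesic b c p &
          on_comb_geodesic a c p].

End CubeComplexTheory.

Section CoarseMedian.
Context {R : realType} {X : metricType R}.

(* Maps out of a cube complex are considered on its vertices, with the
   combinatorial metric. *)
Definition almost_median (m : X -> X -> X -> X) (Q : cube_complex R)
    (mQ : Q -> Q -> Q -> Q) (f : Q -> X) (K : R) : Prop :=
  forall a b c, cc_vertex a -> cc_vertex b -> cc_vertex c ->
    mdist (f (mQ a b c)) (m (f a) (f b) (f c)) <= K.

Definition vertex_quasi_isometry (Q : cube_complex R) (f : Q -> X) (H : set X)
    (k c : R) : Prop :=
  [/\ 1 <= k /\ 0 <= c,
      forall a, cc_vertex a -> H (f a),
      forall a b n, cc_vertex a -> cc_vertex b -> comb_dist a b n ->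
        n%:R / k - c <= mdist (f a) (f b) <= k * n%:R + c &
      forall y, H y -> exists2 a, cc_vertex a & mdist (f a) y <= c].

Definition coarse_median_of_rank (m : X -> X -> X -> X) (h : nat -> nat) (v : nat) : Prop :=
  (forall x y z x' y' z', mdist (m x y z) (m x' y' z') <=
     (h 1%N)%:R * (mdist x x' + mdist y y' + mdist z z')) /\
  (forall n (A : {fset X}), (#|` A| <= n)%N ->
     exists (Q : cube_complex R) (mQ : Q -> Q -> Q -> Q) (f : Q -> X) (g : X -> Q),
       [/\ CAT0_cube_complex Q, cc_finite Q, cc_dim_le Q v & cc_median mQ] /\
       [/\ forall a, a \in A -> cc_vertex (g a),
           almost_median m mQ f (h n)%:R &
           forall a, a \in A -> mdist a (f (g a)) <= (h n)%:R]).

Definition median_interval (m : X -> X -> X -> X) (x y : X) : set X :=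
  [set m x y z | z in [set: X]].

Definition median_join (m : X -> X -> X -> X) (A : set X) : set X :=
  \bigcup_(x in A) \bigcup_(y in A) median_interval m x y.

Definition median_hull (m : X -> X -> X -> X) (v : nat) (A : set X) : set X :=
  iter v (median_join m) A.

(* F is nonempty because no nonempty Q maps to the hull of the empty set. *)
Definition LQC : Prop :=
  exists (m : X -> X -> X -> X) (h : nat -> nat) (v : nat),
    [/\ (0 < v)%N, coarse_median_of_rank m h v &
      exists K : nat -> R, forall F : {fset X}, F != fset0 ->
        exists (Q : cube_complex R) (mQ : Q -> Q -> Q -> Q) (f : Q -> X),
          [/\ CAT0_cube_complex Q, cc_dim_eq Q v & cc_median mQ] /\
          almost_median m mQ f (K #|` F|) /\
          vertex_quasi_isometry f (median_hull m v [set` F]) (K #|` F|) (K #|` F|)].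

End CoarseMedian.
Arguments LQC {R} X.

Section SublinearMorse.
Context {R : realType} {X : metricType R}.

Definition proper_space : Prop := forall (x : X) (r : R), compact [set y | mdist x y <= r].

(* Sublinear functions are only ever evaluated on [0, +oo[. *)
Definition sublinear (kappa : R -> R) : Prop :=
  [/\ forall t, 0 <= t -> 1 <= kappa t,
      forall s t, 0 <= s -> s <= t -> kappa s <= kappa t,
      forall s t l, 0 <= s -> 0 <= t -> 0 <= l <= 1 ->
        l * kappa s + (1 - l) * kappa t <= kappa (l * s + (1 - l) * t) &
      kappa t / t @[t --> +oo] --> (0 : R)].

Definition quasi_geodesic_on (I : set R) (q Q : R) (beta : R -> X) : Prop :=
  [/\ 1 <= q /\ 0 <= Q, {within I, continuous beta} &
      forall s t, I s -> I t ->
        `|s - t| / q - Q <= mdist (beta s) (beta t) <= q * `|s - t| + Q].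

Variable o : X.

Definition quasi_geodesic_ray (q Q : R) (beta : R -> X) : Prop :=
  beta 0 = o /\ quasi_geodesic_on `[0, +oo[ q Q beta.

Definition dist_to (x : X) (Z : set X) : R := inf [set mdist x z | z in Z].

Definition diam (A : set X) : \bar R :=
  ereal_sup [set (mdist p.1 p.2)%:E | p in A `*` A].

Definition kappa_at (kappa : R -> R) (x : X) : R := kappa (mdist x o).

Definition kappa_nbhd (kappa : R -> R) (Z : set X) (n : R) : set X :=
  [set x | dist_to x Z <= n * kappa_at kappa x].

(* By continuity the infimum is attained whenever the sphere of radius r about o
   is met. *)
Definition first_time (beta : R -> X) (r : R) : R :=
  inf [set t | 0 <= t /\ mdist (beta t) o = r].

Definition small_compared_to (kappa : R -> R) (D r : R) : Prop :=
  D <= r / (2 * kappa r).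

(* Preimages of bounded sets are bounded. *)
Definition proper_gauge (m : R -> R -> R) : Prop :=
  forall M, exists B, forall q Q, 0 <= q -> 0 <= Q -> m q Q <= M -> q <= B /\ Q <= B.

Definition nonneg_gauge (m : R -> R -> R) : Prop :=
  forall q Q, 0 <= q -> 0 <= Q -> 0 <= m q Q.

Definition weakly_kappa_Morse (kappa : R -> R) (Z : set X) : Prop :=
  exists2 mZ : R -> R -> R, nonneg_gauge mZ &
    forall q Q (a b : R) (beta : R -> X), a <= b ->
      quasi_geodesic_on `[a, b] q Q beta -> Z (beta a) -> Z (beta b) ->
      beta @` `[a, b] `<=` kappa_nbhd kappa Z (mZ q Q).

Definition kappa_Morse (kappa : R -> R) (Z : set X) : Prop :=
  exists mZ : R -> R -> R, [/\ nonneg_gauge mZ, proper_gauge mZ &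
    forall (kappa' : R -> R) (r : R), sublinear kappa' -> 0 < r ->
      exists2 R0 : R, r <= R0 &
        forall q Q (beta : R -> X), quasi_geodesic_ray q Q beta ->
          small_compared_to kappa (mZ q Q) r ->
          dist_to (beta (first_time beta R0)) Z <= kappa' R0 ->
          beta @` `[0, first_time beta r] `<=` kappa_nbhd kappa Z (mZ q Q)].

(* The sets piZ x are nonempty and C1 is positive: every Z would be contracting if
   piZ x = set0 were allowed, or C1 <= 0. *)
Definition kappa_contracting (kappa : R -> R) (Z : set X) : Prop :=
  exists (piZ : X -> set X) (D1 D2 C1 C2 : R),
    [/\ [/\ 0 < D1, 0 < D2, 0 < C1 & 0 < C2],
        forall x, piZ x `<=` Z /\ piZ x !=set0,
        forall x, (diam ([set x] `|` piZ x) <=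
                   ((D1 + 1) * dist_to x Z + D2 * kappa_at kappa x)%:E)%E &
        forall x y, mdist x y < C1 * dist_to x Z ->
          (diam (piZ x `|` piZ y) <= (C2 * kappa_at kappa x)%:E)%E].

End SublinearMorse.
Arguments proper_space {R} X.

(* Main.v *)
Require Import Defs.
From HB Require Import structures.
From mathcomp Require Import all_boot all_order all_algebra finmap.
From mathcomp Require Import all_classical all_reals all_analysis.
From mathcomp Require Import ring lra zify.

Set Implicit Arguments.
Unset Strict Implicit.
Unset Printing Implicit Defensive.

Import Order.TTheory GRing.Theory Num.Theory.
Import numFieldNormedType.Exports.

Local Open Scope classical_set_scope.
Local Open Scope ring_scope.

(** Let [Z] be the image of [q].

    Contraction implies both Morse properties in every metric space. As long as a
    quasi-geodesic stays outside a large multiple of kappa around [Z], its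
    projection to [Z] moves by a small fraction of its length
    ([projection_drift]), whereas a quasi-geodesic of length [l] has end points at
    distance of order [l]. So the length of an excursion is bounded by the
    distances of its end points to [Z] and by kappa there
    ([excursion_length]): an excursion with two ends near [Z] is O(kappa), and one
    that begins near [o] and reaches a huge sphere at a point sublinearly close to
    [Z] cannot exist ([contracting_path]).

    Conversely, each of the two Morse properties controls the quasi-geodesic rays
    from [o] that end up on [Z] ([Morse_for_returning_rays]), and contraction
    follows from this control alone. A quasi-geodesic from [o] to a point of [q]
    far away can be completed to such a ray without changing a long initial part,
    by leaving it across a gap to [q] that is minimal in a suitable sense
    ([minimal_gap], [join_ray]). Hence such paths and [q] are mutually O(kappa)-close
    inside every given ball ([test_paths]).

    The projection of [x] is taken near [p x], the limit along an ultrafilter of the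
    coarse medians of [o], [x] and [q n]. To see that it contracts, place [o], [x],
    [y] and a far point [z] of [q] in a median graph quasi-isometric to their hull
    ([LQC_median_models]). Everything about median graphs rests on the fact that the
    median of [a], [b], [x] is a gate from [x] to the interval between [a] and [b]
    ([median_gate]). Let [px] and [py] be the medians of [o], [z] with [x] and
    with [y], and let [e] be the median of [px], [y] and [z]; it lies between [px]
    and [py]. If [x] and [y] are close to each other and both far from [Z], then the
    geodesics from [px] towards [x] and [y] have a long common part, and there is
    a rectangle over the geodesic from [px] to [e]. Going around this rectangle
    gives a uniform quasi-geodesic from [o] to [z] that avoids the middle of the
    geodesic from [px] to [e] by a distance comparable to the length of that
    geodesic ([median_detour]). But this middle lies on a geodesic from [o] to [z],
    so it is O(kappa)-close to [q], which in turn is O(kappa)-close to the detour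
    ([model_dichotomy]). So the gap between the projections is O(kappa)
    ([projection_contracts]). *)

(** * Sublinear functions *)

Section Sublinear.
Context {R : realType} (kappa : R -> R).
Hypothesis kappa_sublin : sublinear kappa.

Lemma sublinear_ge1 t : 0 <= t -> 1 <= kappa t.
Proof. by case: kappa_sublin => + _ _ _; apply. Qed.

Lemma sublinear_ge0 t : 0 <= t -> 0 <= kappa t.
Proof. by move=> /sublinear_ge1; apply: le_trans. Qed.

Lemma sublinear_mono s t : 0 <= s -> s <= t -> kappa s <= kappa t.
Proof. by case: kappa_sublin => _ + _ _; apply. Qed.

Lemma sublinear_scale l t : 1 <= l -> 0 <= t -> kappa (l * t) <= l * kappa t.
Proof.
move=> l1 t0; have l0 : 0 < l by apply: lt_le_trans l1.
case: kappa_sublin => k1 _ conc _.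
have lV : 0 <= l^-1 <= 1 by rewrite invr_ge0 ltW//= invf_le1.
have lt0 : 0 <= l * t by rewrite mulr_ge0// ltW.
have := conc (l * t) 0 l^-1 lt0 (lexx _) lV.
rewrite mulr0 addr0 mulKf ?gt_eqF// => h.
rewrite -ler_pdivrMl//; apply: le_trans h; rewrite lerDl mulr_ge0//.
  by rewrite subr_ge0; case/andP: lV.
by rewrite (le_trans _ (k1 0 _)).
Qed.

Lemma sublinearD s t : 0 <= s -> 0 <= t -> kappa (s + t) <= kappa s + kappa t.
Proof.
move=> s0 t0; case: kappa_sublin => k1 mono conc _.
have [/eqP st|stn] := boolP (s + t == 0).
  have [-> ->] : s = 0 /\ t = 0 by split; lra.
  by rewrite addr0 lerDl (le_trans _ (k1 0 _)).
have st0 : 0 < s + t by rewrite lt_neqAle eq_sym stn addr_ge0.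
have aux (a b : R) : 0 <= a -> 0 <= b -> a + b = s + t ->
    a / (s + t) * kappa (s + t) <= kappa a.
  move=> a0 b0 ab; have l01 : 0 <= a / (s + t) <= 1.
    by rewrite divr_ge0 ?addr_ge0//= ler_pdivrMr// mul1r -ab lerDl.
  have := conc (s + t) 0 (a / (s + t)) (ltW st0) (lexx _) l01.
  rewrite mulr0 addr0 divfK// => h; apply: le_trans h; rewrite lerDl mulr_ge0//.
    by rewrite subr_ge0; case/andP: l01.
  by rewrite (le_trans _ (k1 0 _)).
have hs := aux s t s0 t0 erefl; have ht := aux t s t0 s0 (addrC _ _).
by apply: le_trans (lerD hs ht); rewrite -mulrDl -mulrDl divff// mul1r.
Qed.

(** This is where the growth hypothesis on a sublinear function enters all later
    estimates: any multiple of it is absorbed by any fraction of the distance. *)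
Lemma sublinear_absorb D e : 0 <= D -> 0 < e ->
  exists2 E, 0 <= E & forall t, 0 <= t -> D * kappa t <= e * t + E.
Proof.
move=> D0 e0; case: kappa_sublin => k1 mono _ /cvgrPdist_lt lim.
have eps0 : 0 < e / (D + 1) by rewrite divr_gt0// ltr_wpDl.
have [T [_ hT]] := lim _ eps0.
pose T' := Num.max T 0 + 1.
have T'0 : 0 < T' by rewrite ltr_wpDl// le_max lexx orbT.
have TT' : T < T' by rewrite (le_lt_trans (_ : _ <= Num.max T 0)) ?le_max ?lexx// ltrDl.
exists (D * kappa T'); first by rewrite mulr_ge0// (le_trans _ (k1 _ _))// ltW.
move=> t t0; have [tT|Tt] := leP t T'.
  by rewrite ler_wpDl ?mulr_ge0 ?(ltW e0)// ler_wpM2l// mono.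
have tp : 0 < t by apply: lt_trans Tt.
have kt0 : 0 <= kappa t by apply: sublinear_ge0.
apply: ler_wpDr; first by rewrite mulr_ge0// sublinear_ge0// ltW.
have := hT t (lt_trans TT' Tt); rewrite sub0r normrN ger0_norm ?divr_ge0// => h.
move: (ltW h); rewrite ler_pdivrMr// mulrAC ler_pdivlMr ?ltr_wpDl// => {}h.
by apply: le_trans h; rewrite mulrC ler_wpM2l// lerDl.
Qed.

(** By absorption [D * kappa s] is at most half of [s] up to a constant, so [s] is
    at most twice [t] up to a constant. *)
Lemma sublinear_comparable D : 0 <= D -> exists2 C, 1 <= C &
  forall s t, 0 <= s -> 0 <= t -> s <= t + D * kappa s -> kappa s <= C * kappa t.
Proof.
move=> D0; have [E E0 hE] := sublinear_absorb D0 (e := 1 / 2) ltac:(lra).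
exists (2 + kappa (2 * E)).
  by rewrite ler_wpDr ?sublinear_ge0 ?mulr_ge0// ler1n.
move=> s t s0 t0 st; have /(_ _ s0) h := hE.
have {}h : s <= 2 * t + 2 * E by lra.
apply: (le_trans (sublinear_mono s0 h)).
apply: (le_trans (sublinearD _ _)); rewrite ?mulr_ge0//.
rewrite [leRHS]mulrDl lerD// ?sublinear_scale ?ler1n//.
by rewrite ler_peMr ?sublinear_ge0 ?mulr_ge0// sublinear_ge1.
Qed.

Lemma sublinear_affine l e t : 1 <= l -> 0 <= e -> 0 <= t ->
  kappa (l * t + e) <= (l + kappa e) * kappa t.
Proof.
move=> l1 e0 t0; have l0 : 0 <= l by apply: le_trans l1.
apply: (le_trans (sublinearD _ _)); rewrite ?mulr_ge0//.
rewrite [leRHS]mulrDl lerD// ?sublinear_scale//.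
by rewrite ler_peMr ?sublinear_ge0// sublinear_ge1.
Qed.

End Sublinear.

Lemma sublinear_cst {R : realType} (M : R) : 1 <= M -> sublinear (fun _ => M).
Proof.
move=> M1; split=> // [s t l _ _ _|]; first by rewrite -mulrDl subrKC mul1r.
rewrite -[X in _ --> X](mulr0 M); apply: cvgM; first exact: cvg_cst.
by apply/gtr0_cvgV0; [near=> x; near: x; exact: nbhs_pinfty_gt|exact: cvg_id].
Unshelve. all: by end_near.
Qed.

(** * Distance to a set *)

Section Metric.
Context {R : realType} {X : metricType R}.
Implicit Types x y z : X.

Lemma mdist_tri x y z : mdist x z <= mdist x y + mdist y z.
Proof. exact: metric_triangle. Qed.

Lemma mdistC x y : mdist x y = mdist y x.
Proof. exact: metric_sym. Qed.

Lemma mdist_nneg x y : 0 <= mdist x y.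
Proof. exact: mdist_ge0. Qed.

End Metric.
#[global] Hint Extern 0 (is_true (Order.le _ (mdist _ _))) => exact: mdist_nneg : core.

Section DistTo.
Context {R : realType} {X : metricType R}.
Implicit Types (x y z : X) (Z : set X).

Lemma dist_to_le x z Z : Z z -> dist_to x Z <= mdist x z.
Proof.
move=> Zz; apply: ge_inf; last by exists z.
by exists 0 => _ [y _ <-]; exact: mdist_ge0.
Qed.

Lemma dist_to_ge0 x Z : 0 <= dist_to x Z.
Proof.
rewrite /dist_to; have [->|/set0P Z0] := eqVneq [set mdist x z | z in Z] set0.
  by rewrite inf0.
by apply: lb_le_inf => // _ [y _ <-]; exact: mdist_ge0.
Qed.

Lemma dist_to_near x Z e : Z !=set0 -> 0 < e ->
  exists2 z, Z z & mdist x z < dist_to x Z + e.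
Proof.
move=> [z0 Zz0] e0; have [|_ [z Zz <-] h] := @inf_adherent _ [set mdist x z | z in Z] _ e0.
  split; first by exists (mdist x z0), z0.
  by exists 0 => _ [y _ <-]; exact: mdist_ge0.
by exists z.
Qed.

Lemma dist_to_lip x y Z : Z !=set0 -> dist_to x Z <= mdist x y + dist_to y Z.
Proof.
move=> Z0; apply/ler_addgt0Pr => e e0.
have [z Zz h] := dist_to_near y Z0 e0.
have := dist_to_le x Zz; have := mdist_tri x y z; lra.
Qed.

Lemma mdist_le_diam (A : set X) r x y :
  (diam A <= r%:E)%E -> A x -> A y -> mdist x y <= r.
Proof.
move=> h Ax Ay; rewrite -lee_fin; apply: le_trans h.
by apply: ereal_sup_ubound; exists (x, y).
Qed.

Lemma diam_le_mdist (A : set X) r :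
  (forall x y, A x -> A y -> mdist x y <= r) -> (diam A <= r%:E)%E.
Proof. by move=> h; apply: ge_ereal_sup => _ [[x y] [/= Ax Ay] <-]; rewrite lee_fin h. Qed.

End DistTo.

(** * Contracting sets attract quasi-geodesics *)

(** No continuity of the path or of the exit condition is available, so the last
    exit time is located only up to bounded error: [s1] is a time just before it
    and [s] a time just after it. *)
Lemma last_exit {R : realType} (P : R -> Prop) (lo u : R) :
  lo <= u -> P lo -> ~ P u -> exists s1 s,
    [/\ lo <= s1 <= u, P s1, lo <= s <= u, `|s - s1| <= 2 &
        forall v, s <= v <= u -> ~ P v].
Proof.
move=> lou Plo nPu; pose S := [set t | lo <= t <= u /\ P t].
have S0 : S !=set0 by exists lo; split=> //; rewrite lexx.
have hS : has_sup S by split=> //; exists u => t [/andP[_ ?] _].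
have [s1 [s1b Ps1] s1s] := sup_adherent (ltr01 : 0 < 1 :> R) hS.
have s1le : s1 <= sup S by apply: ub_le_sup; case: hS.
have supu : sup S <= u by apply: ge_sup => // t [/andP[]].
have los : lo <= sup S by apply: (le_trans _ s1le); case/andP: s1b.
exists s1, (Num.min (sup S + 1) u); split=> //.
- by rewrite ge_min lexx orbT le_min lou andbT; lra.
- by have [h|h] := leP (sup S + 1) u; rewrite ler_norml; lra.
move=> v /andP[sv vu] Pv; have lov : lo <= v.
  by apply: le_trans sv; rewrite le_min lou andbT; lra.
have vS : v <= sup S by apply: ub_le_sup; [case: hS|split=> //; rewrite lov].
have uv : u <= v by move: sv; rewrite ge_min => /orP[|//]; lra.
by apply: nPu; rewrite (_ : u = v)//; apply/eqP; rewrite eq_le uv vu.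
Qed.

(** The bare distance estimate of a quasi-geodesic, which is stable under restriction
    and reversal; one constant plays both roles. *)
Definition coarse_path {R : realType} {X : metricType R} (N lo hi : R) (b : R -> X) :=
  forall u v, lo <= u <= hi -> lo <= v <= hi ->
    `|u - v| / N - N <= mdist (b u) (b v) <= N * `|u - v| + N.

Lemma coarse_path_sub {R : realType} {X : metricType R} (N lo hi lo' hi' : R)
    (b : R -> X) :
  lo <= lo' -> hi' <= hi -> coarse_path N lo hi b -> coarse_path N lo' hi' b.
Proof.
move=> l h cb u v /andP[u1 u2] /andP[v1 v2]; apply: cb.
  by rewrite (le_trans l u1) (le_trans u2 h).
by rewrite (le_trans l v1) (le_trans v2 h).
Qed.

Lemma coarse_path_opp {R : realType} {X : metricType R} (N lo hi : R) (b : R -> X) :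
  coarse_path N lo hi b -> coarse_path N (- hi) (- lo) (b \o -%R).
Proof.
move=> cb u v ub vb; have -> : `|u - v| = `|- u - - v|.
  by rewrite -[RHS]normrN opprB opprK addrC.
by apply: cb; lra.
Qed.

Section Contracting.
Context {R : realType} {X : metricType R} (o : X) (kappa : R -> R) (Z : set X).
Hypotheses (kappa_sublin : sublinear kappa) (Zo : Z o).

Local Notation "'d'" := (@mdist R X).
Local Notation k := (kappa_at o kappa).
Local Notation dZ x := (dist_to x Z).

Lemma kappa_at_ge1 x : 1 <= k x.
Proof. exact: (sublinear_ge1 kappa_sublin (mdist_nneg x o)). Qed.

Lemma kappa_at_ge0 x : 0 <= k x.
Proof. by apply: le_trans (kappa_at_ge1 x). Qed.

Lemma dist_to_le_norm x : dZ x <= d x o.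
Proof. exact: dist_to_le. Qed.

Lemma kappa_at_le_shift (D : R) x y : 0 <= D -> d x y <= D ->
  k x <= (1 + kappa D) * k y.
Proof.
move=> D0 xy; apply: (@le_trans _ _ (kappa (1 * d y o + D))).
  by apply: sublinear_mono => //; have := mdist_tri x y o; lra.
exact: sublinear_affine.
Qed.

Lemma kappa_at_comparable (D : R) : 0 <= D -> exists2 C, 1 <= C &
  forall x y, d x y <= D * k x -> k x <= C * k y.
Proof.
move=> D0; have [C C1 hC] := sublinear_comparable kappa_sublin D0.
exists C => // x y h; apply: (hC _ _ (mdist_ge0 x o) (mdist_ge0 y o)).
by apply: (le_trans (mdist_tri x y o)); rewrite addrC lerD2l.
Qed.

(** Leaving the [M]-neighbourhood of [Z] along a coarse path happens, up to bounded
    error, at a point that is still close to [Z]. *)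
Lemma exit_left (N M : R) : 1 <= N -> 0 <= M -> exists2 M', 0 <= M' &
  forall b lo hi u, coarse_path N lo hi b -> lo <= u <= hi ->
    dZ (b lo) <= M * k (b lo) -> M * k (b u) < dZ (b u) ->
    exists s, [/\ lo <= s <= u, dZ (b s) <= M' * k (b s) &
      forall v, s <= v <= u -> M * k (b v) < dZ (b v)].
Proof.
move=> N1 M0; have N3 : 0 <= 3 * N by lra.
have kN := sublinear_ge0 kappa_sublin N3.
exists (3 * N + M * (1 + kappa (3 * N))); first by rewrite addr_ge0// mulr_ge0// addr_ge0.
move=> b lo hi u cb /andP[lou uhi] blo bu.
have nbu : ~ dZ (b u) <= M * k (b u) by rewrite leNgt bu.
have [s1 [s [/andP[s11 s12] Ps1 /andP[s_1 s_2] ss1 far]]] :=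
  @last_exit _ (fun t => dZ (b t) <= M * k (b t)) _ _ lou blo nbu.
exists s; split; [by rewrite s_1| |by move=> v /far/negP; rewrite ltNge].
have dss : d (b s) (b s1) <= 3 * N.
  have /andP[_] : `|s - s1| / N - N <= d (b s) (b s1) <= N * `|s - s1| + N.
    by apply: cb; lra.
  move/le_trans; apply; rewrite (_ : 3 * N = N * 2 + N); last by ring.
  by rewrite lerD2r ler_wpM2l//; lra.
have k1 := kappa_at_ge1 (b s).
have ks := kappa_at_le_shift N3 (y := b s) (eq_ind _ (fun r => r <= _) dss _ (mdistC _ _)).
have Z0 : Z !=set0 by exists o.
apply: (le_trans (dist_to_lip (b s) (b s1) Z0)); rewrite mulrDl lerD//.
  by rewrite (le_trans dss)// ler_peMr.
by rewrite (le_trans Ps1)// -mulrA ler_wpM2l.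
Qed.

Lemma exit_right (N M : R) : 1 <= N -> 0 <= M -> exists2 M', 0 <= M' &
  forall b lo hi u, coarse_path N lo hi b -> lo <= u <= hi ->
    dZ (b hi) <= M * k (b hi) -> M * k (b u) < dZ (b u) ->
    exists t, [/\ u <= t <= hi, dZ (b t) <= M' * k (b t) &
      forall v, u <= v <= t -> M * k (b v) < dZ (b v)].
Proof.
move=> N1 M0; have [M' M'0 hM'] := exit_left N1 M0; exists M' => //.
move=> b lo hi u cb ub bhi bu.
have [|||s [sb bs far]] := hM' _ _ _ (- u) (coarse_path_opp cb).
- by lra.
- by rewrite /= opprK.
- by rewrite /= opprK.
exists (- s); split=> //; first by lra.
by move=> v vb; have := far (- v); rewrite /= opprK; apply; lra.
Qed.

Section Projection.
Variables (pi : X -> set X) (D1 D2 C1 C2 : R).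
Hypotheses (D1_ge0 : 0 <= D1) (D2_ge0 : 0 <= D2) (C1_gt0 : 0 < C1)
  (C1_le : C1 <= 1 / 2) (C2_ge0 : 0 <= C2).
Hypothesis pi_ex : forall x, exists a, pi x a.
Hypothesis pi_near : forall x a, pi x a -> d x a <= (D1 + 1) * dZ x + D2 * k x.
Hypothesis pi_contract : forall x y a b, d x y < C1 * dZ x -> pi x a -> pi y b ->
  d a b <= C2 * k x.

(** The path is cut into steps whose length is a fixed fraction of the distance to
    [Z]. Each step moves the projection by O(kappa), which is a small fraction of
    its length because the distance to [Z] is at least a large multiple of kappa.
    The incomplete last step accounts for the term in the end point. *)
Lemma projection_drift (N e : R) : 1 <= N -> 0 < e -> exists2 M, 0 < M &
  forall (n : nat) b s t a1 a2, s <= t -> t - s <= n%:R -> coarse_path N s t b ->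
    (forall v, s <= v <= t -> M * k (b v) < dZ (b v)) ->
    pi (b s) a1 -> pi (b t) a2 ->
    d a1 a2 <= e * (t - s) + 2 * C2 * k (b t).
Proof.
move=> N1 e0; have N0 : 0 < N by apply: lt_le_trans N1.
pose A := 2 * N / C1; pose B := A * C2 / e.
have A0 : 0 < A by rewrite divr_gt0// mulr_gt0.
have B0 : 0 <= B by apply: divr_ge0; rewrite ?(ltW e0)// (mulr_ge0 (ltW A0)).
exists (A + B); first by rewrite ltr_wpDr.
elim=> [|n IH] b s t a1 a2 st tsn cb far pa1 pa2;
  have sb : s <= s <= t by rewrite lexx st.
- have Est : t = s by lra.
  have tb : s <= t <= t by rewrite lexx st.
  subst t; have : d (b s) (b s) < C1 * dZ (b s).
    rewrite mdistxx mulr_gt0// (le_lt_trans _ (far s sb))// mulr_ge0 ?kappa_at_ge0//.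
    by rewrite addr_ge0// ltW.
  move=> /pi_contract/(_ pa1 pa2) h; rewrite subrr mulr0 add0r.
  by apply: (le_trans h); have := mulr_ge0 C2_ge0 (kappa_at_ge0 (b s)); lra.
have tb : s <= t <= t by rewrite lexx st.
set D := dZ (b s); have farD : (A + B) * k (b s) < D by exact: far.
have DA : A < D.
  apply: le_lt_trans farD; rewrite (@le_trans _ _ ((A + B) * 1))//.
    by rewrite mulr1 lerDl.
  by rewrite ler_wpM2l ?kappa_at_ge1// addr_ge0// ltW.
have AC : A * C1 = 2 * N by rewrite /A divfK// gt_eqF.
have DC : 2 * N < C1 * D by rewrite -AC mulrC ltr_pM2l.
have [short|long] := ltP (N * (t - s) + N) (C1 * D).
  have dst : d (b s) (b t) < C1 * D.
    have /andP[_] := cb s t sb tb; rewrite distrC ger0_norm ?subr_ge0// => h.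
    exact: le_lt_trans h short.
  have h := pi_contract dst pa1 pa2.
  have Do : D <= d (b s) o by exact: dist_to_le_norm.
  have kst : k (b s) <= 2 * k (b t).
    apply: (@le_trans _ _ (kappa (2 * d (b t) o))).
      apply: sublinear_mono => //; have := mdist_tri (b s) (b t) o.
      have : C1 * D <= 1 / 2 * D by rewrite ler_wpM2r// dist_to_ge0.
      lra.
    by apply: sublinear_scale => //; lra.
  have et : 0 <= e * (t - s) by rewrite mulr_ge0 ?subr_ge0// ltW.
  by have := ler_wpM2l C2_ge0 kst; lra.
pose th := C1 * D / (2 * N).
have N20 : 0 < 2 * N by rewrite mulr_gt0.
have thE : 2 * N * th = C1 * D by rewrite /th mulrC divfK// gt_eqF.
have th1 : 1 < th by rewrite /th ltr_pdivlMr// mul1r.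
have thst : th <= t - s by nra.
have smb : s <= s + th <= t by lra.
have [a' pa'] := pi_ex (b (s + th)).
have dst : d (b s) (b (s + th)) < C1 * D.
  have /andP[_] := cb s (s + th) sb smb.
  rewrite opprD addNKr normrN ger0_norm; last by lra.
  by move/le_lt_trans; apply; nra.
have h1 := pi_contract dst pa1 pa'.
have h1' : C2 * k (b s) <= e * th.
  have : B * k (b s) <= D.
    by apply: le_trans (ltW farD); rewrite ler_wpM2r ?kappa_at_ge0// lerDr ltW.
  rewrite /B /A /th => BD.
  rewrite (_ : C2 * k (b s) = e * C1 / (2 * N) * (2 * N / C1 * C2 / e * k (b s))).
    rewrite (_ : e * (C1 * D / (2 * N)) = e * C1 / (2 * N) * D).
      by rewrite ler_wpM2l// divr_ge0 ?mulr_ge0// ltW.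
    by field; rewrite gt_eqF.
  by field; rewrite !gt_eqF.
have h2 : d a' a2 <= e * (t - (s + th)) + 2 * C2 * k (b t).
  apply: (IH b (s + th) t a' a2) => //; first by lra.
  - by move: tsn; rewrite -natr1; lra.
  - by apply: coarse_path_sub cb; lra.
  - by move=> v vb; apply: far; lra.
have := mdist_tri a1 a' a2; rewrite [e * (t - s)](_ : _ = e * th + e * (t - (s + th))).
  lra.
by ring.
Qed.

(** The projection moves by a small fraction of the length of an excursion away
    from [Z], while a quasi-geodesic of that length has far apart end points; so
    the length is controlled by the distances of the end points to [Z]. *)
Lemma excursion_length (N : R) : 1 <= N -> exists M E, [/\ 0 < M, 0 <= E &
  forall b s t, s <= t -> coarse_path N s t b ->
    (forall v, s <= v <= t -> M * k (b v) < dZ (b v)) ->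
    t - s <= E * (dZ (b s) + dZ (b t) + (k (b s) + k (b t)))].
Proof.
move=> N1; have N0 : 0 < N by apply: lt_le_trans N1.
have e0 : 0 < 1 / (2 * N) by rewrite divr_gt0// mulr_gt0.
have [M M0 drift] := projection_drift N1 e0.
exists M, (2 * N * (N + (D1 + 1) + (D2 + 2 * C2))); split=> //.
  by rewrite !(mulr_ge0, addr_ge0)// ltW.
move=> b s t st cb far.
have sb : s <= s <= t by rewrite lexx st.
have tb : s <= t <= t by rewrite lexx st.
have [a pa] := pi_ex (b s); have [a' pa'] := pi_ex (b t).
have tsn : t - s <= (Num.bound (t - s))%:R by rewrite ltW// archi_boundP// subr_ge0.
have h := drift _ _ _ _ _ _ st tsn cb far pa pa'.
have := cb s t sb tb; rewrite distrC ger0_norm ?subr_ge0// => /andP[lower _].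
have t1 := mdist_tri (b s) a (b t); have t2 := mdist_tri a a' (b t).
have h1 := pi_near pa; have := pi_near pa'; rewrite mdistC => h2.
have {lower h h1 h2 t1 t2} : (t - s) / (2 * N) <= N + (D1 + 1) * (dZ (b s) + dZ (b t)) +
    D2 * (k (b s) + k (b t)) + 2 * C2 * k (b t).
  have -> : (t - s) / (2 * N) = (t - s) / N - 1 / (2 * N) * (t - s).
    by field; rewrite gt_eqF.
  lra.
rewrite ler_pdivrMr ?mulr_gt0// => /le_trans; apply.
rewrite [X in X <= _]mulrC -[X in _ <= X]mulrA ler_wpM2l ?mulr_ge0 ?(ltW N0)//.
have := kappa_at_ge1 (b s); have := kappa_at_ge1 (b t).
have := dist_to_ge0 (b s) Z; have := dist_to_ge0 (b t) Z.
move: (dZ (b s)) (dZ (b t)) (k (b s)) (k (b t)) => p q k1 k2 p0 q0 k10 k20.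
have D10 := D1_ge0; have C20 := C2_ge0; have pq0 : 0 <= p + q by lra.
have kk : 0 <= k1 + k2 - 1 by lra.
have i1 := mulr_ge0 (ltW N0) (addr_ge0 pq0 kk).
have i2 : 0 <= (D1 + 1) * (k1 + k2) by rewrite mulr_ge0//; lra.
have i3 := mulr_ge0 D2_ge0 pq0.
have i4 : 0 <= C2 * (p + q + k1) by rewrite mulr_ge0//; lra.
lra.
Qed.

End Projection.
End Contracting.

Section ContractingMorse.
Context {R : realType} {X : metricType R} (o : X) (kappa : R -> R) (Z : set X).
Hypotheses (kappa_sublin : sublinear kappa) (Zo : Z o).
Hypothesis contr : kappa_contracting o kappa Z.

Local Notation "'d'" := (@mdist R X).
Local Notation k := (kappa_at o kappa).
Local Notation dZ x := (dist_to x Z).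

Lemma contracting_excursion (N : R) : 1 <= N -> exists M E, [/\ 0 < M, 0 <= E &
  forall b s t, s <= t -> coarse_path N s t b ->
    (forall v, s <= v <= t -> M * k (b v) < dZ (b v)) ->
    t - s <= E * (dZ (b s) + dZ (b t) + (k (b s) + k (b t)))].
Proof.
case: contr => pi [D1 [D2 [C1 [C2 [[D1p D2p C1p C2p] pi_sub pi_near pi_con]]]]] N1.
(* The contraction constant may be decreased. At most 1/2, it makes kappa at the
   beginning of the last step of a path comparable to kappa at its end. *)
have C1'p : 0 < Num.min C1 (1 / 2) by rewrite lt_min C1p; lra.
have C1'le : Num.min C1 (1 / 2) <= 1 / 2 by rewrite ge_min lexx orbT.
apply: (@excursion_length _ _ _ _ _ kappa_sublin Zo pi D1 D2 (Num.min C1 (1 / 2)) C2) => //;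
  rewrite ?ltW//.
- by move=> x; case: (pi_sub x).
- by move=> x a pa; apply: (mdist_le_diam (pi_near x)); [left|right].
- move=> x y a b xy pa pb; apply: (mdist_le_diam (pi_con x y _)); [|by left|by right].
  by apply: (lt_le_trans xy); rewrite ler_wpM2r ?dist_to_ge0// ge_min lexx.
Qed.

(** The length of the excursion is O(kappa) at the end point [e] where kappa is larger,
    so every point of the excursion is O(kappa)-close to [e] and has a comparable
    value of kappa. *)
Lemma short_excursion (N M E : R) : 1 <= N -> 0 <= M -> 0 <= E ->
  exists2 C, 0 <= C & forall b s u t, coarse_path N s t b -> s <= u <= t ->
    dZ (b s) <= M * k (b s) -> dZ (b t) <= M * k (b t) ->
    t - s <= E * (dZ (b s) + dZ (b t) + (k (b s) + k (b t))) ->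
    dZ (b u) <= C * k (b u).
Proof.
move=> N1 M0 E0; have N0 : 0 <= N by apply: le_trans N1.
pose L := N * (E * ((M + 1) * 2)) + N.
have L0 : 0 <= L by rewrite /L addr_ge0// !mulr_ge0// addr_ge0.
have [C C1 hC] := kappa_at_comparable o kappa_sublin L0.
have C0 : 0 <= C by apply: le_trans C1.
exists ((L + M) * C); first exact: (mulr_ge0 (addr_ge0 L0 M0) C0).
move=> b s u t cb /andP[su ut] bs bt len.
have Z0 : Z !=set0 by exists o.
have [e [eb ks kt be]] : exists e, [/\ s <= e <= t, k (b s) <= k (b e),
    k (b t) <= k (b e) & dZ (b e) <= M * k (b e)].
  have [h|h] := leP (k (b s)) (k (b t)).
    by exists t; split; rewrite ?lexx ?(le_trans su ut).
  by exists s; split; rewrite ?lexx ?(le_trans su ut)//= ltW.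
have ke1 := kappa_at_ge1 o kappa_sublin (b e).
have due : d (b e) (b u) <= L * k (b e).
  have /andP[_] : `|e - u| / N - N <= d (b e) (b u) <= N * `|e - u| + N.
    by apply: cb; lra.
  move/le_trans; apply; rewrite /L mulrDl lerD//; last by rewrite ler_peMr.
  rewrite -mulrA ler_wpM2l//.
  apply: (@le_trans _ _ (t - s)); first by rewrite ler_norml; lra.
  apply: (le_trans len); rewrite -mulrA ler_wpM2l//.
  apply: (@le_trans _ _ (M * k (b e) + M * k (b e) + (k (b e) + k (b e)))); last by lra.
  apply: lerD; apply: lerD => //.
    by apply: (le_trans bs); rewrite ler_wpM2l.
  by apply: (le_trans bt); rewrite ler_wpM2l.
have ku := hC _ _ due.
apply: (le_trans (dist_to_lip (b u) (b e) Z0)); rewrite mdistC.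
apply: (@le_trans _ _ ((L + M) * k (b e))); first by rewrite mulrDl lerD.
by rewrite -mulrA ler_wpM2l// addr_ge0.
Qed.

(** A quasi-geodesic segment between points of [Z] makes only short excursions. A
    path from [Z] that is allowed to end sublinearly far from [Z] may also make a
    last excursion without return, but one that starts early would be too long for
    its end conditions. *)
Lemma contracting_path (N : R) : 1 <= N -> exists2 C, 0 <= C &
  (forall b lo hi u, coarse_path N lo hi b -> lo <= u <= hi ->
     Z (b lo) -> Z (b hi) -> dZ (b u) <= C * k (b u)) /\
  forall kappa' (r : R), sublinear kappa' -> 0 < r ->
  exists R1, forall R0 b hi u, R1 <= R0 -> coarse_path N 0 hi b -> b 0 = o ->
    R0 / N - N <= hi <= N * (R0 + N) -> dZ (b hi) <= kappa' R0 ->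
    0 <= u <= N * (r + N) -> u <= hi /\ dZ (b u) <= C * k (b u).
Proof.
move=> N1; have N0 : 0 <= N by apply: le_trans N1.
have [M [E [M0 E0 len]]] := contracting_excursion N1.
have [M1 M10 exitl] := exit_left kappa_sublin Zo N1 (ltW M0).
have [M2 M20 exitr] := exit_right kappa_sublin Zo N1 (ltW M0).
have [C3 C30 short] := short_excursion N1 (addr_ge0 M10 M20) E0.
have dZ_Z x : Z x -> dZ x <= M * k x.
  move=> Zx; apply: (le_trans (dist_to_le x Zx)); rewrite mdistxx.
  by rewrite mulr_ge0 ?(ltW M0) ?(kappa_at_ge0 o kappa_sublin).
have dbl b lo hi u : coarse_path N lo hi b -> lo <= u <= hi ->
    dZ (b lo) <= M * k (b lo) -> dZ (b hi) <= M * k (b hi) ->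
    M * k (b u) < dZ (b u) -> dZ (b u) <= C3 * k (b u).
  move=> cb ub blo bhi far.
  have [s [/andP[los su] bs fars]] := exitl _ _ _ _ cb ub blo far.
  have [t [/andP[ut thi] bt fart]] := exitr _ _ _ _ cb ub bhi far.
  have cb' := coarse_path_sub los thi cb.
  have k0 x := kappa_at_ge0 o kappa_sublin x.
  apply: (short b s u t) => //; first by rewrite su.
  - by apply: (le_trans bs); rewrite ler_wpM2r// lerDl.
  - by apply: (le_trans bt); rewrite ler_wpM2r// lerDr.
  - apply: len => //; first exact: le_trans ut.
    move=> v /andP[sv vt]; have [vu|uv] := leP v u; first by apply: fars; rewrite sv.
    by apply: fart; rewrite (ltW uv).
have k0 x := kappa_at_ge0 o kappa_sublin x.
have M3 x : dZ x <= M * k x -> dZ x <= (M + C3) * k x.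
  by move=> h; apply: (le_trans h); rewrite ler_wpM2r// lerDl.
have C33 x : dZ x <= C3 * k x -> dZ x <= (M + C3) * k x.
  by move=> h; apply: (le_trans h); rewrite ler_wpM2r// lerDr ltW.
exists (M + C3); first by rewrite addr_ge0// ltW.
split=> [b lo hi u cb ub Zlo Zhi|kappa' r kappa'_sub r0].
  have [near|far] := leP (dZ (b u)) (M * k (b u)); first exact: M3.
  by apply/C33/(dbl b lo hi) => //; apply: dZ_Z.
(* An excursion that starts before time [T] and lasts until the sphere of radius
   [R0] has length at least R0 / N minus a constant, but by [len] at most a
   sublinear function of [R0]. *)
pose T := N * (r + N).
have T0 : 0 <= T by rewrite mulr_ge0// addr_ge0// ltW.
pose K := kappa (N * T + N).
have K0 : 0 <= K by apply: sublinear_ge0 => //; rewrite addr_ge0// mulr_ge0.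
pose e := 1 / (8 * N).
have e0 : 0 < e by rewrite divr_gt0// mulr_gt0// (lt_le_trans _ N1).
have [A A0 hA] := sublinear_absorb kappa'_sub E0 e0.
pose L := N * N; pose L' := N * (N * N) + N.
have L1 : 1 <= L by rewrite /L mulr_ege1.
have L'0 : 0 <= L' by rewrite /L' addr_ge0// !mulr_ge0.
have EL0 : 0 <= E * (L + kappa L') by rewrite mulr_ge0// addr_ge0 ?(sublinear_ge0 kappa_sublin)//; lra.
have [B B0 hB] := sublinear_absorb kappa_sublin EL0 e0.
exists (8 * N * (T + 1 + E * (M1 + 1) * K + A + B + 1) + N * T + 8 * (N * N)).
move=> R0 b hi u R1 cb b0 /andP[hi1 hi2] bhi /andP[u0 uT].
have Np : 0 < N by lra.
have W0 : 0 <= E * (M1 + 1) * K.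
  exact: (mulr_ge0 (mulr_ge0 E0 (addr_ge0 M10 ler01)) K0).
have G0 : 0 <= 8 * N * (T + 1 + E * (M1 + 1) * K + A + B + 1).
  apply: mulr_ge0; first exact: mulr_ge0.
  by clear -W0 T0 A0 B0; lra.
have NT0 := mulr_ge0 N0 T0; have NN0 := mulr_ge0 N0 N0.
have R00 : 0 <= R0 by clear -R1 G0 NT0 NN0; lra.
have Thi : T <= hi.
  by apply: le_trans hi1; rewrite lerBrDr ler_pdivlMr// mulrC; clear -R1 G0 NT0 NN0; lra.
have uhi : u <= hi by apply: le_trans Thi.
split=> //; have [near|far] := leP (dZ (b u)) (M * k (b u)); first exact: M3.
have blo : dZ (b 0) <= M * k (b 0) by apply: dZ_Z; rewrite b0.
have [hhi|hhi] := leP (dZ (b hi)) (M * k (b hi)).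
  by apply/C33/(dbl b 0 hi) => //; rewrite u0.
have [[w /andP[uw whi] bw]|nw] := pselect (exists2 w, u <= w <= hi & dZ (b w) <= M * k (b w)).
  apply/C33/(dbl b 0 w) => //; last by rewrite u0.
  by apply: coarse_path_sub cb.
exfalso.
have ub : 0 <= u <= hi by rewrite u0.
have [s [/andP[s0 su] bs fars]] := exitl _ _ _ _ cb ub blo far.
have shi : s <= hi by apply: le_trans uhi.
have := len b s hi shi (coarse_path_sub s0 (lexx _) cb).
have farv v : s <= v <= hi -> M * k (b v) < dZ (b v).
  move=> /andP[sv vhi]; have [vu|uv] := leP v u; first by apply: fars; rewrite sv.
  by rewrite ltNge; apply/negP => h; apply: nw; exists v => //; rewrite (ltW uv).
move=> /(_ farv).
have norm v : 0 <= v <= hi -> d (b v) o <= N * v + N.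
  move=> vb; have /andP[v0 _] := vb; have /andP[_] : `|v - 0| / N - N <= d (b v) (b 0) <= N * `|v - 0| + N.
    by apply: cb => //; rewrite lexx (le_trans u0 uhi).
  by rewrite b0 subr0 ger0_norm.
have ks : k (b s) <= K.
  apply: sublinear_mono => //.
  apply: (le_trans (norm s _)); first by rewrite s0.
  by rewrite lerD2r ler_wpM2l// (le_trans su).
have kh : k (b hi) <= (L + kappa L') * kappa R0.
  apply: (@le_trans _ _ (kappa (L * R0 + L'))); last exact: sublinear_affine.
  apply: sublinear_mono => //.
  apply: (le_trans (norm hi _)); first by rewrite lexx (le_trans u0 uhi).
  rewrite /L /L' (_ : N * N * R0 + (N * (N * N) + N) = N * (N * (R0 + N)) + N).
    by rewrite lerD2r ler_wpM2l.
  by ring.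
have dZs : dZ (b s) <= M1 * K by apply: (le_trans bs); rewrite ler_wpM2l.
have h1 := hA _ R00; have h2 := hB _ R00.
have hE : E * (dZ (b s) + dZ (b hi) + (k (b s) + k (b hi))) <=
    E * (M1 + 1) * K + E * kappa' R0 + E * (L + kappa L') * kappa R0.
  rewrite (_ : E * (M1 + 1) * K + E * kappa' R0 + E * (L + kappa L') * kappa R0 =
    E * (M1 * K + kappa' R0 + (K + (L + kappa L') * kappa R0))); last by ring.
  by rewrite ler_wpM2l// lerD// lerD.
have : e * (8 * N) = 1 by rewrite /e; field; rewrite gt_eqF.
have hi1' : R0 <= hi * N + N * N by move: hi1; rewrite lerBlDr ler_pdivrMr//; lra.
have sT : s <= T by apply: le_trans uT.
move: W0 R1 h1 h2 hE; set W := E * (M1 + 1) * K.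
move: (E * (_ + _)) (E * kappa' R0) (E * _ * kappa R0) => w1 w2 w3.
clearbody W T e; clear -R00 hi1' sT A0 B0 T0 Np shi s0 e0.
move=> W0 R1 h1 h2 h3 eN h4.
have h5 : hi - T <= W + (e * R0 + A) + (e * R0 + B) by lra.
have : (hi - T) * (8 * N) <= (W + A + B) * (8 * N) + 2 * R0.
  have := ler_wpM2r (ltW (mulr_gt0 (ltr0n _ 8) Np)) h5.
  have -> : (W + (e * R0 + A) + (e * R0 + B)) * (8 * N) =
    (W + A + B) * (8 * N) + 2 * (e * (8 * N)) * R0 by ring.
  by rewrite eN mulr1.
nra.
Qed.

End ContractingMorse.

Section QuasiGeodesics.
Context {R : realType} {X : metricType R}.

Lemma quasi_geodesic_coarse_path (I : set R) (q Q N lo hi : R) (b : R -> X) :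
  quasi_geodesic_on I q Q b -> q <= N -> Q <= N ->
  (forall v, lo <= v <= hi -> I v) -> coarse_path N lo hi b.
Proof.
move=> [[q1 Q0] _ qg] qN QN hI u v ub vb.
have /andP[h1 h2] := qg u v (hI u ub) (hI v vb).
have a0 : 0 <= `|u - v| by [].
have q0 : 0 < q by apply: lt_le_trans q1.
apply/andP; split.
  apply: le_trans h1; apply: lerB => //; rewrite ler_wpM2l// lef_pV2// posrE//.
  exact: lt_le_trans qN.
by apply: (le_trans h2); rewrite lerD// ler_wpM2r.
Qed.

Lemma mdist_continuous (o : X) : continuous (fun x => mdist x o).
Proof.
move=> x; apply/cvgrPdist_lt => e e0; near=> y.
have xy : mdist x y < e.
  by near: y; apply/nbhs_ballP; exists e => // y; rewrite ballEmdist.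
apply: le_lt_trans xy; have := mdist_tri x y o; have := mdist_tri y x o.
by rewrite (mdistC y x) ler_norml; lra.
Unshelve. all: by end_near.
Qed.

Lemma first_time_bounds (o : X) (q Q r : R) (b : R -> X) :
  quasi_geodesic_ray o q Q b -> 0 <= r ->
  (r - Q) / q <= first_time o b r <= q * (r + Q).
Proof.
move=> [b0 [[q1 Q0] cont qg]] r0; have q0 : 0 < q by apply: lt_le_trans q1.
have I0 (v : R) : 0 <= v -> [set` `[0, +oo[] v by rewrite /= in_itv/= andbT.
have bnd (t : R) : 0 <= t -> t / q - Q <= mdist (b t) o <= q * t + Q.
  by move=> t0; have := qg t 0 (I0 _ t0) (I0 _ (lexx _)); rewrite b0 subr0 ger0_norm.
pose S := [set t | 0 <= t /\ mdist (b t) o = r].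
have lbS t : S t -> (r - Q) / q <= t.
  by move=> [t0 <-]; have /andP[_] := bnd t t0; rewrite ler_pdivrMr//; lra.
have ubS t : S t -> t <= q * (r + Q).
  by move=> [t0 <-]; have /andP[+ _] := bnd t t0; rewrite lerBlDr ler_pdivrMr//; lra.
have [t St] : S !=set0.
  pose T := q * (r + Q).
  have T0 : 0 <= T by rewrite mulr_ge0 ?(ltW q0)// addr_ge0.
  have cT : {within `[0, T], continuous (fun t => mdist (b t) o)}.
    have c1 : {within `[0, T], continuous b}.
      by apply: continuous_subspaceW cont => v /=; rewrite !in_itv/= andbT => /andP[].
    by move=> x; exact: (continuous_comp (c1 x) (@mdist_continuous o (b x))).
  have /andP[hT _] := bnd T T0.
  have [|c] := IVT (v := r) T0 cT; last first.
    by rewrite in_itv => /andP[c0 _] fc; exists c.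
  rewrite b0 mdistxx (min_idPl _)// (max_idPr _)// r0/=.
  by move: hT; rewrite /T mulrC mulKf ?gt_eqF//; lra.
apply/andP; split; first by apply: lb_le_inf; [exists t|exact: lbS].
apply: (le_trans _ (ubS t St)); apply: ge_inf => //.
by exists ((r - Q) / q).
Qed.

End QuasiGeodesics.

Lemma bounded_initial {R : realType} (f : nat -> R) (n : nat) :
  exists B, forall i, (i <= n)%N -> f i <= B.
Proof.
elim: n => [|n [B hB]]; first by exists (f 0%N) => i; rewrite leqn0 => /eqP->.
exists (Num.max B (f n.+1)) => i; rewrite leq_eqVlt => /orP[/eqP->|/hB h].
  by rewrite le_max lexx orbT.
by rewrite le_max h.
Qed.

Section ContractingImplies.
Context {R : realType} {X : metricType R} (o : X) (kappa : R -> R) (Z : set X).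
Hypotheses (kappa_sublin : sublinear kappa) (Zo : Z o).

(* Replacing both constants by one integer bound makes the constants depend on
   finitely many cases over each bounded range of (q, Q). *)
Let bound (q Q : R) : nat := (Num.truncn (`|q| + `|Q|)).+1.

Lemma bound_ge (q Q : R) : [/\ 1 <= (bound q Q)%:R :> R, q <= (bound q Q)%:R & Q <= (bound q Q)%:R].
Proof.
have h : `|q| + `|Q| < (bound q Q)%:R by apply: truncnS_gt.
have h1 := ler_norm q; have h2 := ler_norm Q.
have h3 := normr_ge0 q; have h4 := normr_ge0 Q.
split; first by rewrite ler1n.
  by apply: (le_trans h1); apply/ltW/(le_lt_trans _ h); rewrite lerDl.
by apply: (le_trans h2); apply/ltW/(le_lt_trans _ h); rewrite lerDr.
Qed.

Theorem contracting_weakly_Morse :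
  kappa_contracting o kappa Z -> weakly_kappa_Morse o kappa Z.
Proof.
move=> contr.
have /choice[C hC] : forall n : nat, exists C, 0 <= C /\
    forall b lo hi u, coarse_path n.+1%:R lo hi b -> lo <= u <= hi ->
     Z (b lo) -> Z (b hi) -> dist_to (b u) Z <= C * kappa_at o kappa (b u).
  move=> n; have n1 : 1 <= n.+1%:R :> R by rewrite ler1n.
  by have [C C0 [h _]] := contracting_path kappa_sublin Zo contr n1; exists C.
exists (fun q Q => C (bound q Q).-1) => [q Q _ _|q Q a b beta ab qg Za Zb].
  by case: (hC (bound q Q).-1).
move=> x [t /= + <-]; rewrite in_itv/= => tab.
have [n1 qn Qn] := bound_ge q Q; have [_ h] := hC (bound q Q).-1; apply: (h beta a b) => //.
by apply: (quasi_geodesic_coarse_path qg qn Qn) => v; rewrite /= in_itv.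
Qed.

Theorem contracting_Morse : kappa_contracting o kappa Z -> kappa_Morse o kappa Z.
Proof.
move=> contr.
have /choice[C hC] : forall n : nat, exists C, 0 <= C /\
    forall kappa' (r : R), sublinear kappa' -> 0 < r ->
    exists R1, forall R0 b hi u, R1 <= R0 -> coarse_path n.+1%:R 0 hi b -> b 0 = o ->
    R0 / n.+1%:R - n.+1%:R <= hi <= n.+1%:R * (R0 + n.+1%:R) -> dist_to (b hi) Z <= kappa' R0 ->
    0 <= u <= n.+1%:R * (r + n.+1%:R) -> u <= hi /\ dist_to (b u) Z <= C * kappa_at o kappa (b u).
  move=> n; have n1 : 1 <= n.+1%:R :> R by rewrite ler1n.
  by have [C C0 [_ h]] := contracting_path kappa_sublin Zo contr n1; exists C.
have C0 n : 0 <= C n by case: (hC n).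
exists (fun q Q => C (bound q Q).-1 + (`|q| + `|Q|)); split.
- by move=> q Q _ _; rewrite !addr_ge0.
- move=> M; exists M => q Q q0 Q0; rewrite !ger0_norm//.
  by have := C0 (bound q Q).-1; lra.
move=> kappa' r sub' r0.
have /choice[R1 hR1] := fun n => (hC n).2 kappa' r sub' r0.
have [B hB] := bounded_initial R1 (Num.truncn r).
exists (Num.max r B); first by rewrite le_max lexx.
set R0 := Num.max r B; move=> q Q b ray small bR x [u /= + <-].
rewrite in_itv/= => /andP[u0 ur].
have [b0 qg'] := ray; have [[q1 Q0] _ _] := qg'.
have kr : 1 <= kappa r by apply: (sublinear_ge1 kappa_sublin); exact: ltW.
have qQr : `|q| + `|Q| <= r.
  have : C (bound q Q).-1 + (`|q| + `|Q|) <= r.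
    apply: (le_trans small); rewrite ler_pdivrMr ?mulr_gt0//; last by lra.
    by rewrite ler_peMr ?(ltW r0)//; lra.
  by have := C0 (bound q Q).-1; lra.
have nr : (Num.truncn (`|q| + `|Q|) <= Num.truncn r)%N by apply: le_truncn.
have RB : R1 (bound q Q).-1 <= R0.
  by apply: (le_trans (hB _ nr)); rewrite le_max lexx orbT.
have [n1 qn Qn] := bound_ge q Q.
have q0 : 0 < q by apply: lt_le_trans q1.
have R00 : 0 <= R0 by rewrite le_max (ltW r0).
have /andP[f1 f2] := first_time_bounds ray R00.
have f3' : first_time o b r <= (bound q Q)%:R * (r + (bound q Q)%:R).
  have /andP[_ h] := first_time_bounds ray (ltW r0).
  apply: (le_trans h); apply: ler_pM; rewrite ?lerD2l ?(ltW q0)//.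
  by rewrite addr_ge0// ltW.
have cb : coarse_path (bound q Q)%:R 0 (first_time o b R0) b.
  apply: quasi_geodesic_coarse_path qg' qn Qn _ => v /= /andP[v0 _].
  by rewrite in_itv/= v0.
have N0 : 0 < (bound q Q)%:R :> R by apply: lt_le_trans n1.
have hb : R0 / (bound q Q)%:R - (bound q Q)%:R <= first_time o b R0 <=
    (bound q Q)%:R * (R0 + (bound q Q)%:R).
  apply/andP; split.
    apply: le_trans f1; rewrite mulrBl lerB//.
      by rewrite ler_wpM2l// lef_pV2.
    by apply: le_trans Qn; rewrite ler_pdivrMr// ler_peMr.
  apply: (le_trans f2); apply: ler_pM; rewrite ?lerD2l ?(ltW q0)//.
  by rewrite addr_ge0.
have ub : 0 <= u <= (bound q Q)%:R * (r + (bound q Q)%:R) by rewrite u0 (le_trans ur f3').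
have [_ h] := hR1 _ _ _ _ _ RB cb b0 hb bR ub.
apply: (le_trans h); rewrite ler_wpM2r ?(kappa_at_ge0 o kappa_sublin)// lerDl.
by rewrite addr_ge0.
Qed.

End ContractingImplies.

(** * Rays that return to the set *)

(** Common weakening of the two Morse properties; it only concerns rays that end up
    on [Z], so that neither segments nor asymptotic hypotheses are involved. *)
Definition Morse_for_returning_rays {R : realType} {X : metricType R} (o : X)
    (kappa : R -> R) (Z : set X) :=
  exists2 m : R -> R -> R, nonneg_gauge m &
    forall q Q b, quasi_geodesic_ray o q Q b ->
      (exists M T, forall t, T <= t -> dist_to (b t) Z <= M) ->
      (forall T, exists2 t, T <= t & Z (b t)) ->
      forall t, 0 <= t -> dist_to (b t) Z <= m q Q * kappa_at o kappa (b t).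

Section ReturningRays.
Context {R : realType} {X : metricType R} (o : X) (kappa : R -> R) (Z : set X).
Hypotheses (kappa_sublin : sublinear kappa) (Zo : Z o).

Lemma weakly_Morse_returning :
  weakly_kappa_Morse o kappa Z -> Morse_for_returning_rays o kappa Z.
Proof.
move=> [m m0 h]; exists m => // q Q b [b0 [qQ cont qg]] _ ret t t0.
have [T tT ZT] := ret t; have T0 := le_trans t0 tT.
have sub : [set` `[0, T]] `<=` [set` `[0, +oo[].
  by move=> v /=; rewrite !in_itv/= andbT => /andP[].
have qg' : quasi_geodesic_on [set` `[0, T]] q Q b.
  by split=> //; [exact: continuous_subspaceW cont|move=> u v /sub uI /sub vI; exact: qg].
apply: (h q Q 0 T b T0 qg' _ ZT); first by rewrite b0.
by exists t => //=; rewrite in_itv/= t0.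
Qed.

(** A returning ray stays at bounded distance from [Z], so that the hypothesis in
    the Morse property holds with a constant comparison function at every radius. *)
Lemma kappa_Morse_returning :
  kappa_Morse o kappa Z -> Morse_for_returning_rays o kappa Z.
Proof.
move=> [m [m0 _ h]]; exists m => // q Q b ray [M [T bM]] _ t t0.
have [b0 [[q1 Q0] _ _]] := ray.
have q0 : 0 < q by apply: lt_le_trans q1.
have mq0 : 0 <= m q Q by apply: m0 => //; exact: ltW.
have M1 : 1 <= Num.max 1 M by rewrite le_max lexx.
have m20 : 0 <= 2 * m q Q by rewrite mulr_ge0.
have [E E0 hE] := sublinear_absorb kappa_sublin m20 (e := 1 / 2) ltac:(lra).
(* The radius is chosen so that the gauge is small compared to it, and so that the
   ray passes the times [t] and [T] before leaving the ball of that radius. *)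
pose r := 2 * E + q * (`|t| + `|T|) + Q + 1.
have qT0 : 0 <= q * (`|t| + `|T|) by rewrite mulr_ge0 ?addr_ge0// ltW.
have r0 : 0 < r by rewrite /r; lra.
have [R0 rR0 hR0] := h _ r (sublinear_cst M1) r0.
have kr := sublinear_ge1 kappa_sublin (ltW r0).
have small : small_compared_to kappa (m q Q) r.
  rewrite /small_compared_to ler_pdivlMr; last by rewrite mulr_gt0//; lra.
  by have := hE r (ltW r0); rewrite /r; lra.
have time r' : r <= r' -> `|t| + `|T| <= first_time o b r'.
  move=> rr'; have r'0 := le_trans (ltW r0) rr'.
  have /andP[+ _] := first_time_bounds ray r'0; apply: le_trans.
  by rewrite ler_pdivlMr// mulrC; move: rr'; rewrite /r; lra.
have nT := ler_norm T; have nt := ler_norm t.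
have nT0 := normr_ge0 T; have nt0 := normr_ge0 t.
apply: (hR0 q Q b ray small).
  rewrite le_max bM ?orbT//; have := time _ rR0; lra.
by exists t => //=; rewrite in_itv/= t0; have := time _ (lexx r); lra.
Qed.

End ReturningRays.

(** * Discrete quasi-geodesics *)

(** As the steps are bounded only the lower bound on distances needs to be
    imposed, and continuity is replaced by the bound on the steps. *)
Definition discrete_ray {R : realType} {X : metricType R} (N : R) (b : nat -> X) :=
  (forall i, mdist (b i) (b i.+1) <= N) /\
  (forall i j, (i <= j)%N -> (j - i)%:R / N - N <= mdist (b i) (b j)).

Definition discrete_path {R : realType} {X : metricType R} (N : R) (S : nat) (b : nat -> X) :=
  (forall i, (i < S)%N -> mdist (b i) (b i.+1) <= N) /\
  (forall i j, (i <= j)%N -> (j <= S)%N -> (j - i)%:R / N - N <= mdist (b i) (b j)).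

Lemma lipschitz_glue {R : realType} {X : metricType R} (N : R) (f : R -> X) :
  (forall (n : nat) s t, n%:R <= s -> s <= t -> t <= n.+1%:R ->
     mdist (f s) (f t) <= N * (t - s)) ->
  forall s t, 0 <= s -> s <= t -> mdist (f s) (f t) <= N * (t - s).
Proof.
move=> loc; suff h (n : nat) s t : 0 <= s -> s <= t -> t <= n%:R ->
    mdist (f s) (f t) <= N * (t - s).
  move=> s t s0 st; apply: (h (Num.truncn t).+1) => //.
  exact/ltW/truncnS_gt.
elim: n s t => [|n IH] s t s0 st tn.
  have [-> ->] : s = 0 /\ t = 0 by split; lra.
  by rewrite mdistxx subrr mulr0.
have [tn'|nt] := leP t n%:R; first exact: IH.
have [ns|sn] := leP n%:R s; first exact: (loc n).
apply: (le_trans (mdist_tri _ (f n%:R) _)).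
have := IH s n%:R s0 (ltW sn) (lexx _); have := loc n n%:R t (lexx _) (ltW nt) tn.
by lra.
Qed.

Lemma lipschitz_within_continuous {R : realType} {X : metricType R} (N : R) (f : R -> X) :
  0 < N -> (forall s t, 0 <= s -> s <= t -> mdist (f s) (f t) <= N * (t - s)) ->
  {within `[0, +oo[, continuous f}.
Proof.
move=> N0 lip; apply/subspace_continuousP => x /=; rewrite in_itv/= andbT => x0.
apply/(@metricType_numDomainType.cvgrPdist_lt _ X) => e e0.
have eN : 0 < e / N by rewrite divr_gt0.
near=> y.
have y0 : 0 <= y.
  have : [set` `[0, +oo[] y by near: y; exact: withinT.
  by rewrite /= in_itv/= andbT.
have xy : `|x - y| < e / N.
  by near: y; apply: cvg_within; apply/nbhs_ballP; exists (e / N).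
have {}xy : N * `|x - y| < e by rewrite mulrC -ltr_pdivlMr.
apply: le_lt_trans xy; have [h|h] := leP x y.
  by rewrite distrC ger0_norm ?subr_ge0//; exact: lip.
rewrite ger0_norm ?subr_ge0 ?(ltW h)//.
by apply: le_trans (lip y x y0 (ltW h)); rewrite le_eqVlt mdistC eqxx.
Unshelve. all: by end_near.
Qed.

Section Interpolation.
Context {R : realType} {X : metricType R}.
Hypothesis geo : geodesic_space (@mdist R X).

(** Geodesics between consecutive points; each point is within [N] of the sample at
    the integer part of its time, which costs 2 N + 1 in the additive constant. *)
Lemma discrete_ray_interpolation (N : R) (b : nat -> X) : 1 <= N -> discrete_ray N b ->
  exists beta : R -> X, [/\ quasi_geodesic_ray (b 0%N) N (3 * N + 1) beta,
    forall i : nat, beta i%:R = b i &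
    forall t, 0 <= t -> mdist (beta t) (b (Num.truncn t)) <= N].
Proof.
move=> N1 [step low]; have N0 : 0 < N by apply: lt_le_trans N1.
have /choice[g hg] : forall i, exists g, geodesic (@mdist R X) (b i) (b i.+1) g.
  by move=> i; exact: geo.
pose D i := mdist (b i) (b i.+1).
pose beta t := g (Num.truncn t) ((t - (Num.truncn t)%:R) * D (Num.truncn t)).
have betaE (n : nat) t : n%:R <= t -> t <= n.+1%:R -> beta t = g n ((t - n%:R) * D n).
  move=> nt; rewrite le_eqVlt => /orP[/eqP ->|tn].
    rewrite /beta natrK subrr mul0r -natr1 addrC addKr mul1r.
    by have [-> _ _] := hg n.+1; have [_ -> _] := hg n.
  have -> // : beta t = g n ((t - n%:R) * D n).
  by rewrite /beta (truncn_def (n := n))// nt tn.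
have betan (i : nat) : beta i%:R = b i.
  by rewrite (betaE i)// ?ler_nat// subrr mul0r; have [] := hg i.
have loc (n : nat) s t : n%:R <= s -> s <= t -> t <= n.+1%:R ->
    mdist (beta s) (beta t) <= N * (t - s).
  move=> ns st tn; rewrite (betaE n s) ?(le_trans st)// (betaE n t) ?(le_trans ns)//.
  have D0 : 0 <= D n by exact: mdist_ge0.
  have tn1 : t <= n%:R + 1 by rewrite natr1.
  have [_ _ iso] := hg n; rewrite iso; last 2 first.
  - rewrite mulr_ge0 ?subr_ge0//= ler_piMl//; lra.
  - rewrite mulr_ge0 ?subr_ge0 ?(le_trans ns)//= ler_piMl//; lra.
  rewrite -mulrBl normrM (ger0_norm D0) distrC mulrC.
  have -> : `|t - n%:R - (s - n%:R)| = t - s by rewrite ger0_norm; lra.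
  by rewrite ler_wpM2r ?subr_ge0//; exact: step.
have lip := lipschitz_glue loc.
have close t : 0 <= t -> mdist (beta t) (b (Num.truncn t)) <= N.
  move=> t0; rewrite -betan mdistC.
  have /andP[h1 h2] := truncn_itv t0.
  apply: (le_trans (lip _ _ (ler0n _ _) h1)); rewrite ler_piMr ?(ltW N0)//.
  by move: h2; rewrite -natr1; lra.
exists beta; split=> //; split; first by rewrite (betan 0%N).
have lower s t : 0 <= s -> s <= t -> (t - s) / N - (3 * N + 1) <= mdist (beta s) (beta t).
  move=> s0 st; have t0 := le_trans s0 st.
  have := low (Num.truncn s) (Num.truncn t) (le_truncn st).
  have := close s s0; have := close t t0.
  have /andP[s1 s2] := truncn_itv s0; have /andP[t1 t2] := truncn_itv t0.
  have t3 := mdist_tri (b (Num.truncn s)) (beta s) (b (Num.truncn t)).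
  have t4 := mdist_tri (beta s) (beta t) (b (Num.truncn t)).
  rewrite (mdistC (beta s)) natrB ?le_truncn// => c1 c2 c3.
  have : (t - s - 1) / N <= ((Num.truncn t)%:R - (Num.truncn s)%:R) / N.
    by rewrite ler_pM2r ?invr_gt0//; move: t2; rewrite -natr1; lra.
  rewrite mulrBl mul1r; have : N^-1 <= 1 by rewrite invf_le1.
  lra.
split; first by split => //; lra.
  exact: lipschitz_within_continuous N0 lip.
move=> s t /=; rewrite !in_itv/= !andbT => s0 t0.
wlog st : s t s0 t0 / s <= t.
  move=> W; have [/W|/ltW/W] := leP s t; first exact.
  by rewrite distrC mdistC; exact.
rewrite distrC ger0_norm ?subr_ge0// lower//=.
by apply: (le_trans (lip _ _ s0 st)); lra.
Qed.

End Interpolation.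

Section DiscreteReturningRays.
Context {R : realType} {X : metricType R} (o : X) (kappa : R -> R) (Z : set X).
Hypotheses (kappa_sublin : sublinear kappa) (Zo : Z o).
Hypothesis geo : geodesic_space (@mdist R X).
Hypothesis returning : Morse_for_returning_rays o kappa Z.

Local Notation "'d'" := (@mdist R X).
Local Notation k := (kappa_at o kappa).
Local Notation dZ x := (dist_to x Z).

Lemma discrete_returning (N : R) : 1 <= N -> exists2 M, 0 <= M &
  forall b, discrete_ray N b -> b 0%N = o -> (exists n, forall i, (n <= i)%N -> Z (b i)) ->
    forall i, dZ (b i) <= M * k (b i).
Proof.
move=> N1; have [m m0 hm] := returning; exists (m N (3 * N + 1)).
  by apply: m0; lra.
move=> b db b0 [n bZ] i.
have [beta [ray betan close]] := discrete_ray_interpolation geo N1 db.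
rewrite b0 in ray; rewrite -betan; apply: hm ray _ _ _ (ler0n _ _).
  exists N, n%:R => t nt; have t0 : 0 <= t by apply: le_trans nt.
  have Zb : Z (b (Num.truncn t)) by apply: bZ; rewrite -(natrK (R := R) n) le_truncn.
  exact: (le_trans (dist_to_le _ Zb) (close t t0)).
move=> T; exists (maxn n (Num.truncn T).+1)%:R.
  by rewrite (le_trans (ltW (truncnS_gt T)))// ler_nat leq_maxr.
by rewrite betan; apply: bZ; rewrite leq_maxl.
Qed.

End DiscreteReturningRays.

Section Shadowing.
Context {R : realType} {X : metricType R} (o : X) (kappa : R -> R) (q : R -> X) (a : R).
Hypotheses (kappa_sublin : sublinear kappa) (a1 : 1 <= a) (q0 : q 0 = o).
Hypothesis q_coarse : forall T, coarse_path a 0 T q.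

Local Notation "'d'" := (@mdist R X).
Local Notation k := (kappa_at o kappa).
Local Notation Z := (q @` `[0, +oo[).

(** The times on [q] of the points of [q] that are near [b 0], [b 1], ... start at
    [0] and are unbounded, so they jump over any given time [t]; the jump is
    O(kappa) as the two points of [b] involved are at bounded distance. *)
Lemma shadow_onto (N M : R) : 1 <= N -> 0 <= M -> exists2 M', 0 <= M' &
  forall b, discrete_ray N b -> b 0%N = o ->
    (forall i, dist_to (b i) Z <= M * k (b i)) ->
    forall t, 0 <= t -> exists i, d (q t) (b i) <= M' * k (q t).
Proof.
move=> N1 M0; have N0 : 0 <= N by apply: le_trans N1.
have a0 : 0 < a by apply: lt_le_trans a1.
have kN := sublinear_ge0 kappa_sublin N0.
pose J := (M + 1) * (2 + kappa N) + N + a.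
have J0 : 0 <= J by rewrite /J !addr_ge0 ?mulr_ge0 ?addr_ge0// ltW.
pose L := a * (a * J) + a + (M + 1).
have L0 : 0 <= L by rewrite /L !addr_ge0 ?mulr_ge0// ltW.
have [C C1 hC] := kappa_at_comparable o kappa_sublin L0.
exists (L * C); first by rewrite mulr_ge0// (le_trans _ C1).
move=> b [step low] b0 near t t0.
have Z0 : Z !=set0 by exists (q 0), 0 => //=; rewrite in_itv/= lexx.
pose nr i tau := 0 <= tau /\ d (b i) (q tau) <= (M + 1) * k (b i).
have nr_ex i : exists tau, nr i tau.
  have [_ [tau /= + <-] h] := dist_to_near (b i) Z0 ltr01.
  rewrite in_itv/= andbT => tau0; exists tau; split=> //.
  apply: (le_trans (ltW h)); rewrite mulrDl mul1r lerD ?near//.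
  exact: (kappa_at_ge1 o kappa_sublin).
have norm u : 0 <= u -> d (q u) o <= a * u + a.
  move=> u0; have /andP[_] : `|u - 0| / a - a <= d (q u) (q 0) <= a * `|u - 0| + a.
    by apply: (q_coarse (T := u)); rewrite lexx u0.
  by rewrite q0 subr0 ger0_norm.
have [[i [[tau nrt tt] [tau' nrt' tt']]]|no] := pselect (exists i,
    (exists2 tau, nr i tau & tau <= t) /\ (exists2 tau, nr i.+1 tau & t < tau)).
  exists i; have [tau0 h] := nrt; have [_ h'] := nrt'.
  have ki1 := kappa_at_ge1 o kappa_sublin (b i).
  have ks : k (b i.+1) <= (1 + kappa N) * k (b i).
    by apply: kappa_at_le_shift => //; rewrite mdistC.
  have M10 : 0 <= M + 1 by rewrite addr_ge0.
  have hM := ler_wpM2l M10 ks.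
  have jump : tau' - tau <= a * J * k (b i).
    have tau'0 : tau <= tau' by rewrite (le_trans tt)// ltW.
    have /andP[+ _] : `|tau' - tau| / a - a <= d (q tau') (q tau) <= a * `|tau' - tau| + a.
      by apply: (q_coarse (T := tau')); rewrite ?lexx ?tau0 ?(le_trans tau0).
    rewrite ger0_norm ?subr_ge0// lerBlDr ler_pdivrMr// => /le_trans; apply.
    rewrite mulrC -mulrA ler_wpM2l ?(ltW a0)//.
    apply: (@le_trans _ _ ((M + 1) * k (b i) + N + (M + 1) * k (b i.+1) + a)).
      have := mdist_tri (q tau') (b i.+1) (q tau); have := mdist_tri (b i.+1) (b i) (q tau).
      by have := step i; rewrite (mdistC (q tau') (b i.+1)) (mdistC (b i.+1) (b i)); lra.
    have : 0 <= N * (k (b i) - 1) by rewrite mulr_ge0 ?subr_ge0.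
    have : 0 <= a * (k (b i) - 1) by rewrite mulr_ge0 ?subr_ge0 ?(ltW a0).
    by rewrite /J; lra.
  have qt : d (b i) (q t) <= L * k (b i).
    have /andP[_] : `|t - tau| / a - a <= d (q t) (q tau) <= a * `|t - tau| + a.
      by apply: (q_coarse (T := t)); rewrite ?lexx ?t0 ?tau0.
    rewrite ger0_norm ?subr_ge0// => h1.
    have h2 : a * (t - tau) <= a * (a * J * k (b i)).
      by rewrite ler_wpM2l ?(ltW a0)// (le_trans _ jump)//; lra.
    have := mdist_tri (b i) (q tau) (q t); rewrite (mdistC (q tau) (q t)).
    have : 0 <= a * (k (b i) - 1) by rewrite mulr_ge0 ?subr_ge0 ?(ltW a0).
    by rewrite /L; lra.
  rewrite mdistC; apply: (le_trans qt); rewrite -mulrA ler_wpM2l//; exact: hC.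
exfalso; have all i : exists2 tau, nr i tau & tau <= t.
  elim: i => [|i IH].
    exists 0 => //; split=> //; rewrite q0 b0 mdistxx.
    by rewrite mulr_ge0 ?addr_ge0// (kappa_at_ge0 o kappa_sublin).
  have [tau ntau] := nr_ex i.+1; have [h|h] := leP tau t; first by exists tau.
  by exfalso; apply: no; exists i; split=> //; exists tau.
have [E E0 hE] := sublinear_absorb kappa_sublin (addr_ge0 M0 ler01) (e := 1 / 2) ltac:(lra).
pose B := 2 * (E + a * t + a).
have bnd i : i%:R <= N * (B + N).
  have [tau [tau0 h] tt] := all i.
  have := low 0%N i (leq0n _); rewrite subn0 b0 lerBlDr ler_pdivrMr; last by lra.
  move=> /le_trans; apply; rewrite mulrC ler_wpM2l// lerD2r mdistC.
  have h1 := norm tau tau0; have h2 := hE (d (b i) o) (mdist_ge0 _ _).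
  have h3 : a * tau <= a * t by rewrite ler_wpM2l// ltW.
  have := mdist_tri (b i) (q tau) o; move: h; rewrite /kappa_at /B; lra.
have := bnd (Num.truncn (N * (B + N))).+1.
by rewrite leNgt truncnS_gt.
Qed.

End Shadowing.

(** * Joining a path to a quasi-geodesic ray *)

Section Concatenation.
Context {R : realType} {X : metricType R}.
Implicit Types (N : R) (S : nat) (b : nat -> X).

Lemma discrete_rayP N b : (forall S, discrete_path N S b) -> discrete_ray N b.
Proof.
move=> h; split=> [i|i j ij]; first by case: (h i.+1) => + _; apply.
by case: (h j) => _; apply.
Qed.

Lemma discrete_path_weaken N N' S b :
  1 <= N -> N <= N' -> discrete_path N S b -> discrete_path N' S b.
Proof.
move=> N1 NN' [step low]; split=> [i iS|i j ij jS]; first exact: le_trans (step i iS) NN'.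
have N0 : 0 < N by apply: lt_le_trans N1.
apply: le_trans (low i j ij jS); apply: lerB => //.
by rewrite ler_wpM2l// lef_pV2// posrE (lt_le_trans N0).
Qed.

Lemma discrete_path_perturb N e S b b' : 1 <= N -> 0 <= e -> discrete_path N S b ->
  (forall i, (i <= S)%N -> mdist (b i) (b' i) <= e) -> discrete_path (N + 2 * e) S b'.
Proof.
move=> N1 e0 pb bb'; have NN : N <= N + 2 * e by rewrite lerDl mulr_ge0.
have [step low] := pb; have [_ low'] := discrete_path_weaken N1 NN pb.
split=> [i iS|i j ij jS].
  have := step i iS; have := bb' i (ltnW iS); have := bb' _ iS.
  have := mdist_tri (b' i) (b i) (b' i.+1); have := mdist_tri (b i) (b i.+1) (b' i.+1).
  by rewrite (mdistC (b' i) (b i)); lra.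
have := low i j ij jS; have := bb' i (leq_trans ij jS); have := bb' _ jS.
have := mdist_tri (b i) (b' i) (b j); have := mdist_tri (b' i) (b' j) (b j).
have : (j - i)%:R / (N + 2 * e) <= (j - i)%:R / N.
  by rewrite ler_wpM2l// lef_pV2// posrE; lra.
by rewrite (mdistC (b' j) (b j)); lra.
Qed.

Definition cat_path S b1 b2 i : X := if (i < S)%N then b1 i else b2 (i - S)%N.

Lemma cat_path_left S b1 b2 i : b1 S = b2 0%N -> (i <= S)%N -> cat_path S b1 b2 i = b1 i.
Proof.
by move=> e; rewrite /cat_path leq_eqVlt => /orP[/eqP->|->//]; rewrite ltnn subnn.
Qed.

Lemma cat_path_right S b1 b2 i : cat_path S b1 b2 (S + i) = b2 i.
Proof. by rewrite /cat_path ltnNge leq_addr/= addnC addnK. Qed.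

Lemma discrete_path_cat N S1 S2 b1 b2 : 0 < N ->
  discrete_path N S1 b1 -> discrete_path N S2 b2 -> b1 S1 = b2 0%N ->
  (forall i j, (i <= S1)%N -> (j <= S2)%N ->
     (S1 - i + j)%:R <= N * (mdist (b1 i) (b2 j) + N)) ->
  discrete_path N (S1 + S2) (cat_path S1 b1 b2).
Proof.
move=> N0 [step1 low1] [step2 low2] e cross.
split=> [i iS|i j ij jS].
  have [iS1|S1i] := ltnP i S1.
    by rewrite !cat_path_left// 1?ltnW//; exact: step1.
  rewrite -(subnKC S1i) -addnS !cat_path_right; apply: step2.
  by rewrite ltn_subLR.
have [jS1|S1j] := leqP j S1.
  by rewrite !cat_path_left// ?(leq_trans ij)//; exact: low1.
rewrite -[in X in mdist _ X](subnKC (ltnW S1j)) cat_path_right.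
have jS2 : (j - S1 <= S2)%N by rewrite leq_subLR.
have [iS1|S1i] := leqP i S1.
  rewrite cat_path_left// lerBlDr ler_pdivrMr// mulrC.
  have := cross i (j - S1)%N iS1 jS2; rewrite (_ : S1 - i + (j - S1) = j - i)%N//.
  lia.
rewrite -[in X in mdist X _](subnKC (ltnW S1i)) cat_path_right.
have := low2 (i - S1)%N (j - S1)%N; rewrite (_ : j - S1 - (i - S1) = j - i)%N; last by lia.
by apply; rewrite ?leq_sub2r.
Qed.

End Concatenation.

Lemma image_ray {R : realType} {X : metricType R} (q : R -> X) (u : R) :
  0 <= u -> (q @` `[0, +oo[) (q u).
Proof. by move=> u0; exists u => //; rewrite /= in_itv/= u0. Qed.

Section Joining.
Context {R : realType} {X : metricType R} (o : X) (q : R -> X) (a : R).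
Hypotheses (a1 : 1 <= a) (q0 : q 0 = o).
Hypothesis q_coarse : forall T, coarse_path a 0 T q.
Hypothesis geo : geodesic_space (@mdist R X).

Local Notation "'d'" := (@mdist R X).
Local Notation Z := (q @` `[0, +oo[).

Lemma ray_coarse (u v : R) : 0 <= u -> u <= v -> (v - u) / a - a <= d (q u) (q v) <= a * (v - u) + a.
Proof.
move=> u0 uv; have := q_coarse (T := v) (u := u) (v := v).
by rewrite distrC ger0_norm ?subr_ge0// u0 uv lexx (le_trans u0 uv); apply.
Qed.

Lemma ray_norm (u : R) : 0 <= u -> u / a - a <= d (q u) o <= a * u + a.
Proof. by move=> u0; have := ray_coarse (lexx 0) u0; rewrite q0 subr0 mdistC. Qed.

Lemma ray_samples (t : nat) (S : nat) : discrete_path (2 * a) S (fun j => q (t + j)%:R).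
Proof.
have a0 : 0 < a by apply: lt_le_trans a1.
have aa := a1.
split=> [i _|i j ij _].
  have /andP[_] := @ray_coarse (t + i)%:R (t + i.+1)%:R (ler0n _ _) ltac:(by rewrite ler_nat leq_add2l).
  by move/le_trans; apply; rewrite addnS -natr1; lra.
have /andP[+ _] := @ray_coarse (t + i)%:R (t + j)%:R (ler0n _ _) ltac:(by rewrite ler_nat leq_add2l).
apply: le_trans; rewrite -natrB ?leq_add2l// subnDl; apply: lerB; last by lra.
by rewrite ler_wpM2l// lef_pV2// ?posrE; lra.
Qed.

(** A minimal pair for a functional that rewards a small gap, a small time on the
    path and a large time on the ray; the coefficients are such that the value at
    the given end of the path beats the value at every small [s]. *)
Lemma minimal_gap (N : R) : 1 <= N -> exists2 L, 1 <= L &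
  forall rho : nat, exists T0 : nat, forall (T S : nat) P, (T0 <= T)%N ->
    discrete_path N S P -> d (P 0%N) o <= N -> d (P S) (q T%:R) <= N ->
    exists s t : nat, [/\ (rho <= s)%N, (s <= S)%N &
      forall s' t', (s' <= s)%N -> (t <= t')%N ->
        L * d (P s) (q t%:R) + (s - s')%:R + (t' - t)%:R <= L * d (P s') (q t'%:R)].
Proof.
move=> N1; have N0 : 0 < N by apply: lt_le_trans N1.
have a0 : 0 < a by apply: lt_le_trans a1.
(* The weight [mu] exceeds the number of steps that the path spends per unit of
   time on [q], so the functional is very negative at the end of the path; with the
   weight [L] of the gap it is bounded below for bounded [s]. *)
pose mu := N * a + 1; pose L := a * (mu + 1).
have mu1 : 1 <= mu by rewrite /mu lerDr mulr_ge0// ltW.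
have L1 : 1 <= L by rewrite /L mulr_ege1//; lra.
have L0 : 0 <= L by apply: le_trans L1.
exists L => // rho.
pose B := L * N + N * (a + 3 * N) + L * (a + (N + N * rho%:R)).
exists (Num.truncn B).+1 => T S P T0T [step low] P0 PS.
have BT : B < T%:R by apply: (lt_le_trans (truncnS_gt B)); rewrite ler_nat.
have P0i i : (i <= S)%N -> d (P 0%N) (P i) <= N * i%:R.
  elim: i => [|i IH] iS; first by rewrite mdistxx mulr0.
  apply: (le_trans (mdist_tri _ (P i) _)); rewrite -natr1 mulrDr mulr1.
  by apply: lerD; [exact: IH (ltnW iS)|exact: step].
have normP i : (i <= S)%N -> d (P i) o <= N + N * i%:R.
  move=> iS; have := P0i i iS; have := mdist_tri (P i) (P 0%N) o.
  by rewrite (mdistC (P i) (P 0%N)); lra.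
pose F (x : nat * nat) : R := L * d (P x.1) (q x.2%:R) + x.1%:R - mu * x.2%:R.
have F_low s t : (s <= S)%N -> t%:R - L * (a + (N + N * s%:R)) <= F (s, t).
  move=> sS; rewrite /F/=; have /andP[+ _] := ray_norm (ler0n R t).
  have := normP s sS; have := mdist_tri (q t%:R) (P s) o.
  rewrite (mdistC (q t%:R) (P s)) lerBlDr ler_pdivrMr// => h1 h2 h3.
  have : L * (t%:R / a) <= L * (d (P s) (q t%:R) + (N + N * s%:R) + a).
    by rewrite ler_wpM2l// ler_pdivrMr//; apply: (le_trans h3); rewrite ler_wpM2r ?(ltW a0)//; lra.
  have -> : L * (t%:R / a) = (mu + 1) * t%:R by rewrite /L; field; rewrite gt_eqF.
  have : 0 <= s%:R :> R by [].
  lra.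
have FST : F (S, T) <= L * N + N * (a + 3 * N) - T%:R.
  have SN : S%:R <= N * (a * T%:R + a + 3 * N).
    have := low 0%N S (leq0n _) (leqnn _); rewrite subn0 lerBlDr ler_pdivrMr// mulrC.
    move/le_trans; apply; rewrite ler_wpM2l ?(ltW N0)//.
    have /andP[_] := ray_norm (ler0n R T).
    have := mdist_tri (P 0%N) o (P S); have := mdist_tri o (q T%:R) (P S).
    by rewrite (mdistC (q T%:R) (P S)) (mdistC o (q T%:R)); lra.
  have : L * d (P S) (q T%:R) <= L * N by rewrite ler_wpM2l.
  by rewrite /F/= /mu; lra.
pose T1 := maxn T (Num.truncn (F (S, T) + L * (a + (N + N * S%:R)))).+1.
have TT1 : (T < T1.+1)%N by rewrite ltnS leq_maxl.
pose x0 : 'I_S.+1 * 'I_T1.+1 := (ord_max, Ordinal TT1).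
case: (@Order.TotalTheory.arg_minP _ _ _ x0 xpredT (fun x => F (val x.1, val x.2))) => //= -[s t] _ /= hmin.
have {}hmin s' t' : (s' <= S)%N -> F (val s, val t) <= F (s', t').
  move=> s'S; have [t'T1|T1t'] := leqP t' T1.
    have s'S1 : (s' < S.+1)%N by rewrite ltnS.
    have t'T2 : (t' < T1.+1)%N by rewrite ltnS.
    exact: (hmin (Ordinal s'S1, Ordinal t'T2)).
  apply: (le_trans (hmin x0 isT)); apply: le_trans (F_low s' t' s'S).
  rewrite /= lerBrDr.
  have : F (S, T) + L * (a + (N + N * S%:R)) < t'%:R.
    apply: (lt_le_trans (truncnS_gt _)); rewrite ler_nat.
    by apply: leq_trans (ltnW T1t'); rewrite leq_maxr.
  have : L * (a + (N + N * s'%:R)) <= L * (a + (N + N * S%:R)).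
    by rewrite ler_wpM2l// lerD2l lerD2l ler_wpM2l ?(ltW N0)// ler_nat.
  lra.
have sS : (val s <= S)%N by rewrite -ltnS ltn_ord.
exists (val s), (val t); split=> //.
  rewrite leqNgt; apply/negP => srho.
  have := hmin S T (leqnn _); have := F_low (val s) (val t) sS.
  have : L * (a + (N + N * (val s)%:R)) <= L * (a + (N + N * rho%:R)).
    by rewrite ler_wpM2l// lerD2l lerD2l ler_wpM2l ?(ltW N0)// ler_nat ltnW.
  have : 0 <= (val t)%:R :> R by [].
  move: BT FST; rewrite /B; lra.
move=> s' t' s's tt'; have := hmin s' t' (leq_trans s's sS); rewrite /F/=.
have : 0 <= (mu - 1) * (t' - val t)%:R by rewrite mulr_ge0// subr_ge0.
by rewrite !natrB//; lra.
Qed.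

(** Leave the path at a minimal gap, cross the gap along a geodesic and follow [q]:
    by minimality the distance between points of different pieces is at least a
    fixed fraction of the length between them. *)
Lemma join_ray (N : R) : 1 <= N -> exists2 N', 1 <= N' &
  forall rho : nat, exists T0 : nat, forall (T S : nat) P, (T0 <= T)%N ->
    discrete_path N S P -> d (P 0%N) o <= N -> d (P S) (q T%:R) <= N ->
    (rho <= S)%N /\ exists b, [/\ discrete_ray N' b, b 0%N = o,
      exists n, forall i, (n <= i)%N -> Z (b i) &
      forall i, (i <= rho)%N -> d (b i) (P i) <= N].
Proof.
move=> N1; have [L L1 hL] := minimal_gap N1.
have N0 : 0 < N by apply: lt_le_trans N1.
have a0 : 0 < a by apply: lt_le_trans a1.
pose K := N + 2 * a + L; have aa := a1.
have K1 : 1 <= K by rewrite /K; have := ltW a0; lra.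
have K0 : 0 < K by apply: lt_le_trans K1.
exists (K + 2 * N); first by lra.
move=> rho; have [T0 hT0] := hL rho; exists T0 => T S P T0T pP P0 PS.
have [s [t [rhos sS gap]]] := hT0 T S P T0T pP P0 PS.
split; first exact: leq_trans sS.
have [g [g0 gD iso]] := geo (P s) (q t%:R).
set D := d (P s) (q t%:R) in gD iso gap.
have D0 : 0 <= D by exact: mdist_ge0.
pose n := (Num.truncn D).+1.
have nD : n%:R <= D + 1 by rewrite /n -natr1 lerD2r; have /andP[] := truncn_itv D0.
have Dn : D <= n%:R by exact/ltW/truncnS_gt.
pose G (j : nat) := g (Num.min j%:R D).
have minD j : 0 <= Num.min j%:R D <= D by rewrite le_min ler0n D0 ge_min lexx orbT.
have isoG i j : (i <= j)%N -> d (G i) (G j) = Num.min j%:R D - Num.min i%:R D.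
  move=> ij; rewrite iso ?minD// distrC ger0_norm// subr_ge0.
  by rewrite le_min ge_min ler_nat ij ge_min lexx orbT.
have Gs j : d (P s) (G j) = Num.min j%:R D.
  by rewrite -g0 iso ?minD// ?lexx ?D0// sub0r normrN ger0_norm//; case/andP: (minD j).
have Gt j : d (G j) (q t%:R) = D - Num.min j%:R D.
  by rewrite -[in LHS]gD iso ?minD// ?lexx ?D0// distrC ger0_norm// subr_ge0; case/andP: (minD j).
have G0 : G 0%N = P s by rewrite /G (min_idPl _).
have Gn : G n = q (t + 0)%:R by rewrite /G (min_idPr _)// addn0.
have minS i : Num.min i.+1%:R D <= Num.min i%:R D + 1.
  by rewrite -natr1; have [h|h] := leP i%:R D; [rewrite ge_min lexx|rewrite ge_min lerDl ler01 orbT].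
have min_ge i : (i <= n)%N -> i%:R - 1 <= Num.min i%:R D.
  rewrite -(ler_nat R) le_min => h; apply/andP; split; first by rewrite gerBl.
  by move: nD; lra.
have L0 : 0 < L by apply: lt_le_trans L1.
have to_path (x y : R) : 0 <= y -> x <= L * y + 1 -> x <= K * (y + K).
  move=> y0 h; apply: (le_trans h); rewrite mulrDr lerD//.
    by rewrite ler_wpM2r// /K; have := ltW a0; lra.
  by rewrite mulr_ege1.
have pG : discrete_path K n G.
  split=> [i _|i j ij jn].
    by rewrite isoG//; have := minS i; have := ltW a0; rewrite /K; lra.
  rewrite lerBlDr ler_pdivrMr// mulrC to_path// isoG// natrB//.
  have : 0 <= (L - 1) * (Num.min j%:R D - Num.min i%:R D).
    by rewrite mulr_ge0 ?subr_ge0// le_min ge_min ler_nat ij ge_min lexx orbT.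
  have := min_ge j jn; have : Num.min i%:R D <= i%:R by rewrite ge_min lexx.
  lra.
have pq m : discrete_path K m (fun j => q (t + j)%:R).
  have pq' := @ray_samples t m.
  by apply: (discrete_path_weaken _ _ pq'); rewrite /K; have := ltW a0; lra.
have pGq m : discrete_path K (n + m) (cat_path n G (fun j => q (t + j)%:R)).
  apply: discrete_path_cat => // i j i_n _; apply: to_path => //.
  have := gap s (t + j)%N (leqnn _) (leq_addr _ _).
  rewrite subnn addr0 addKn => h.
  have := mdist_tri (P s) (G i) (q (t + j)%:R); rewrite Gs => h1.
  have := ler_wpM2l (ltW L0) h1; rewrite mulrDr => h2.
  have : 0 <= (L - 1) * (D - Num.min i%:R D).
    by rewrite mulr_ge0 ?subr_ge0//; case/andP: (minD i).
  have : Num.min i%:R D <= i%:R by rewrite ge_min lexx.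
  by rewrite natrD natrB//; lra.
have pP' : discrete_path K s P.
  have NK : N <= K by rewrite /K; have := ltW a0; lra.
  have [step low] := discrete_path_weaken N1 NK pP.
  split=> [i iS|i j ij jS]; first by apply: step; apply: leq_trans sS.
  by apply: low => //; apply: leq_trans sS.
pose Q := cat_path n G (fun j => q (t + j)%:R).
have pPQ m : discrete_path K (s + (n + m)) (cat_path s P Q).
  apply: (discrete_path_cat K0 pP' (pGq m)); first by rewrite cat_path_left.
  move=> i j i_s _; apply: to_path => //.
  have i_s' : (s - i)%:R = s%:R - i%:R :> R by rewrite natrB.
  have [jn|nj] := leqP j n.
    rewrite /Q cat_path_left//.
    have := gap i t i_s (leqnn _); rewrite subnn addr0 => h.
    have := mdist_tri (P i) (G j) (q t%:R); rewrite Gt => h1.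
    have := ler_wpM2l (ltW L0) h1; rewrite mulrDr => h2.
    have := min_ge j jn.
    have : 0 <= (L - 1) * Num.min j%:R D.
      by rewrite mulr_ge0 ?subr_ge0//; case/andP: (minD j).
    by rewrite natrD; lra.
  rewrite /Q -(subnKC (ltnW nj)) cat_path_right.
  have := gap i (t + (j - n))%N i_s (leq_addr _ _); rewrite addKn => h.
  have : 0 <= (L - 1) * D by rewrite mulr_ge0 ?subr_ge0.
  have -> : (s - i + (n + (j - n)))%:R = (s - i)%:R + (n%:R + (j - n)%:R) :> R.
    by rewrite !natrD.
  lra.
pose b i := if i is 0%N then o else cat_path s P Q i.
have QP i : (i <= s)%N -> cat_path s P Q i = P i.
  by move=> i_s; rewrite cat_path_left// /Q cat_path_left.
have bP i : mdist (cat_path s P Q i) (b i) <= N.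
  by case: i => [|i]; rewrite /b ?mdistxx ?(ltW N0)// QP.
exists b; split=> //.
- apply: discrete_rayP => m.
  have [st low] := discrete_path_perturb K1 (ltW N0) (pPQ m) (fun i _ => bP i).
  have ms : (m <= s + (n + m))%N by rewrite addnA leq_addl.
  split=> [i im|i j ij jm]; first by apply: st; exact: leq_trans ms.
  by apply: low => //; exact: leq_trans ms.
- exists (s + n).+1 => -[//|i] sni; rewrite /b.
  have -> : i.+1 = (s + (n + (i.+1 - (s + n))))%N by clear -sni; lia.
  by rewrite cat_path_right /Q cat_path_right; apply: image_ray.
- by move=> i irho; rewrite mdistC -QP//; exact: leq_trans rhos.
Qed.

End Joining.

Section TestPaths.
Context {R : realType} {X : metricType R} (o : X) (kappa : R -> R) (q : R -> X) (a : R).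
Hypotheses (kappa_sublin : sublinear kappa) (a1 : 1 <= a) (q0 : q 0 = o).
Hypothesis q_coarse : forall T, coarse_path a 0 T q.
Hypothesis geo : geodesic_space (@mdist R X).
Local Notation "'d'" := (@mdist R X).
Local Notation k := (kappa_at o kappa).
Local Notation Z := (q @` `[0, +oo[).
Hypothesis returning : Morse_for_returning_rays o kappa Z.

(** Complete the path to a returning ray that follows it up to an index beyond which
    the ray stays outside of the ball. That the path is close to [q] is then the
    Morse property, and that [q] is close to the path is [shadow_onto]. *)
Lemma test_paths (N : R) : 1 <= N -> exists2 M, 1 <= M &
  forall B : R, 0 <= B -> exists T0 : nat, forall (T S : nat) P, (T0 <= T)%N ->
    discrete_path N S P -> d (P 0%N) o <= N -> d (P S) (q T%:R) <= N ->
    (forall i, (i <= S)%N -> d (P i) o <= B -> dist_to (P i) Z <= M * k (P i)) /\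
    (forall t, 0 <= t -> d (q t) o <= B ->
       exists2 i, (i <= S)%N & d (q t) (P i) <= M * k (q t)).
Proof.
move=> N1; have N0 : 0 <= N by apply: le_trans N1.
have Zo : Z o by rewrite -q0; exact: image_ray.
have Zn0 : Z !=set0 by exists o.
have [N' N'1 join] := join_ray a1 q0 q_coarse geo N1.
have N'0 : 0 < N' by apply: lt_le_trans N'1.
have [M0 M00 near] := discrete_returning geo returning N'1.
have [M1 M10 onto] := shadow_onto kappa_sublin a1 q0 q_coarse N'1 M00.
have kN := sublinear_ge0 kappa_sublin N0.
have MK0 : 0 <= M0 * (1 + kappa N) by rewrite mulr_ge0// addr_ge0.
exists (N + M0 * (1 + kappa N) + M1); first by lra.
move=> B B0; have kB := sublinear_ge0 kappa_sublin B0.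
have M1B : 0 <= M1 * kappa B by rewrite mulr_ge0.
pose rho := (Num.truncn (N * (B + 2 * N) + N' * (B + M1 * kappa B + N'))).+1.
have NB0 : 0 <= N * (B + 2 * N) by rewrite mulr_ge0//; lra.
have NB0' : 0 <= N' * (B + M1 * kappa B + N') by rewrite mulr_ge0//; lra.
have rhoP (i : nat) : i%:R <= N * (B + 2 * N) + N' * (B + M1 * kappa B + N') -> (i <= rho)%N.
  by move=> h; rewrite -(ler_nat R); apply: (le_trans h); exact/ltW/truncnS_gt.
have [T0 hT0] := join rho; exists T0 => T S P T0T pP P0 PS.
have [rhoS [b [rb b0 bZ bP]]] := hT0 T S P T0T pP P0 PS.
have nearb := near b rb b0 bZ; have [_ lowb] := rb; have [_ low] := pP.
split=> [i iS Pi|t t0 qt].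
  have irho : (i <= rho)%N.
    apply: rhoP; have := low 0%N i (leq0n _) iS.
    rewrite subn0 lerBlDr ler_pdivrMr; last by lra.
    have := mdist_tri (P 0%N) o (P i); rewrite (mdistC o (P i)) => h1 h2.
    have : (d (P 0%N) (P i) + N) * N <= (B + 2 * N) * N by rewrite ler_wpM2r//; lra.
    lra.
  have bPi := bP i irho; have k1 := kappa_at_ge1 o kappa_sublin (P i).
  have ks := kappa_at_le_shift o kappa_sublin N0 bPi.
  have := ler_wpM2l M00 ks; have := nearb i.
  have := dist_to_lip (P i) (b i) Zn0; rewrite (mdistC (P i) (b i)).
  have : 0 <= N * (k (P i) - 1) by rewrite mulr_ge0// subr_ge0.
  have : 0 <= M1 * k (P i) by rewrite mulr_ge0//; lra.
  lra.
have [i hi] := onto b rb b0 nearb t t0.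
have kt : k (q t) <= kappa B by apply: sublinear_mono.
have M1kt := ler_wpM2l M10 kt.
have irho : (i <= rho)%N.
  apply: rhoP; have := lowb 0%N i (leq0n _).
  rewrite subn0 b0 lerBlDr ler_pdivrMr//.
  have := mdist_tri o (q t) (b i); rewrite (mdistC o (q t)) => h1 h2.
  have : (d o (b i) + N') * N' <= (B + M1 * kappa B + N') * N'.
    by rewrite ler_wpM2r ?(ltW N'0)//; lra.
  lra.
exists i; first exact: leq_trans rhoS.
have := bP i irho; have := mdist_tri (q t) (b i) (P i).
have k1 := kappa_at_ge1 o kappa_sublin (q t).
have : 0 <= N * (k (q t) - 1) by rewrite mulr_ge0// subr_ge0.
have : 0 <= M0 * (1 + kappa N) * k (q t) by rewrite mulr_ge0//; lra.
lra.
Qed.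

End TestPaths.

(** * Median graphs *)

(** The 1-skeleton of a CAT(0) cube complex in purely metric terms. *)
Record median_graph := MedianGraph {
  mg_vertex :> Type;
  mg_dist : mg_vertex -> mg_vertex -> nat;
  mg_med : mg_vertex -> mg_vertex -> mg_vertex -> mg_vertex;
  mg_distxx : forall x, mg_dist x x = 0%N;
  mg_distC : forall x y, mg_dist x y = mg_dist y x;
  mg_tri : forall x y z, (mg_dist x z <= mg_dist x y + mg_dist y z)%N;
  mg_geo : forall x y, exists w : nat -> mg_vertex,
    [/\ w 0%N = x, w (mg_dist x y) = y &
        forall i j, (i <= j)%N -> (j <= mg_dist x y)%N -> mg_dist (w i) (w j) = (j - i)%N];
  mg_medP : forall x y z p,
    [/\ mg_dist x p + mg_dist p y = mg_dist x y, mg_dist y p + mg_dist p z = mg_dist y z &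
        mg_dist x p + mg_dist p z = mg_dist x z]%N <-> p = mg_med x y z }.

Section MedianGraph.
Variable V : median_graph.
Implicit Types (a b c e o p s t u v x y z : V).
Local Notation D := (@mg_dist V).
Local Notation m := (@mg_med V).

Definition btw a p b := (D a p + D p b)%N = D a b.

Lemma btw_sym a p b : btw a p b -> btw b p a.
Proof. by rewrite /btw (mg_distC b a) (mg_distC b p) (mg_distC p a) addnC. Qed.

Lemma btwxx a b : btw a a b.
Proof. by rewrite /btw mg_distxx. Qed.

Lemma btw_right a p t b : btw a p b -> btw p t b -> btw a t b /\ btw a p t.
Proof.
rewrite /btw => h1 h2.
have := mg_tri a t b; have := mg_tri a p t; have := mg_tri a p b; lia.
Qed.

Lemma btw_left a p t b : btw a p b -> btw a t p -> btw a t b /\ btw t p b.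
Proof.
move=> /btw_sym h1 /btw_sym h2; have [/btw_sym h3 /btw_sym h4] := btw_right h1 h2.
by split.
Qed.

Lemma med_btw a b c : [/\ btw a (m a b c) b, btw b (m a b c) c & btw a (m a b c) c].
Proof. by apply/mg_medP. Qed.

Lemma med_unique a b c p : btw a p b -> btw b p c -> btw a p c -> p = m a b c.
Proof. by move=> h1 h2 h3; apply/mg_medP. Qed.

Lemma med_rot a b c : m b c a = m a b c.
Proof.
have [h1 h2 h3] := med_btw b c a.
by apply: med_unique => //; exact: btw_sym.
Qed.

Lemma med_swap a b c : m a c b = m a b c.
Proof.
have [h1 h2 h3] := med_btw a c b.
by apply: med_unique => //; exact: btw_sym.
Qed.

(** Projecting [x] to the subinterval from [a] to [t] and then moving towards [b]
    produces a point with the defining property of the median of [a], [b], [x]. *)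
Lemma median_gate a b x t : btw a t b -> btw x (m a b x) t.
Proof.
move=> atb; have [h1 h2 h3] := med_btw a t x; set q := m a t x in h1 h2 h3.
have [k1 k2 k3] := med_btw q b x; set r := m q b x in k1 k2 k3.
have [aqb _] := btw_left atb h1; have [arb _] := btw_right aqb k1.
have [arx _] := btw_right h3 k3.
rewrite -(med_unique arb k2 arx).
by have [] := btw_left (btw_sym h2) (btw_sym k3).
Qed.

Lemma median_lipschitz a b x y : (D (m a b x) (m a b y) <= D x y)%N.
Proof.
have [h1 _ _] := med_btw a b x; have [h2 _ _] := med_btw a b y.
have := median_gate x h2; have := median_gate y h1; rewrite /btw.
have := mg_tri x y (m a b y); have := mg_tri y x (m a b x).
by rewrite (mg_distC y x) (mg_distC (m a b y) (m a b x)); lia.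
Qed.

(** By the gate property [e] is the median of [p], [p'] and [z], hence symmetric in
    [x] and [y]. *)
Lemma med_triangle o x y z (p := m o x z) (p' := m o y z) (e := m p y z) :
  btw p e p' /\ m p' x z = e.
Proof.
suff h x1 y1 (p1 := m o x1 z) (p2 := m o y1 z) (e1 := m p1 y1 z) :
    [/\ btw p1 e1 p2, btw p2 e1 z & btw p1 e1 z].
  have [h1 h2 h3] := h x y; have [/btw_sym k1 k2 k3] := h y x.
  by split=> //; exact: etrans (med_unique k1 k3 k2) (esym (med_unique h1 h2 h3)).
have [_ _ opz] := med_btw o x1 z; rewrite -/p1 in opz.
have [ey1 ey2 ey3] := med_btw p1 y1 z; rewrite -/e1 in ey1 ey2 ey3.
have [oez _] := btw_right opz ey3.
have gate t : btw o t z -> btw y1 p2 t.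
  by rewrite /p2 (_ : m o y1 z = m o z y1); [exact: median_gate|
    rewrite -med_rot; have [g1 g2 g3] := med_btw y1 z o;
    apply: med_unique; exact: btw_sym].
have g1 := gate _ oez; have g2 := gate _ opz.
have [_ g3] := btw_left ey2 g1; split=> //.
move: g1 g2 ey1; rewrite /btw (mg_distC p1 y1) (mg_distC p1 p2) (mg_distC e1 y1) (mg_distC e1 p2).
lia.
Qed.

Definition geodesic_seq a b (w : nat -> V) :=
  [/\ w 0%N = a, w (D a b) = b &
      forall i j, (i <= j)%N -> (j <= D a b)%N -> D (w i) (w j) = (j - i)%N].

Lemma geodesic_seq_btw a b w i : geodesic_seq a b w -> (i <= D a b)%N ->
  btw a (w i) b /\ D a (w i) = i.
Proof.
move=> [w0 wD h] iD; have := h 0%N i (leq0n _) iD; have := h i _ iD (leqnn _).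
by rewrite w0 wD /btw; lia.
Qed.

Lemma geodesic_seq_through a p b : btw a p b -> exists2 w, geodesic_seq a b w &
  w (D a p) = p.
Proof.
move=> apb; have [w1 [w10 w1D h1]] := mg_geo a p; have [w2 [w20 w2D h2]] := mg_geo p b.
pose w i := if (i <= D a p)%N then w1 i else w2 (i - D a p)%N.
have e1 : w (D a p) = p by rewrite /w leqnn.
exists w => //; split; first by rewrite /w leq0n.
  rewrite /w; case: leqP => h; last by rewrite -apb addKn.
  have e0 : D p b = 0%N by move: h; rewrite -apb; lia.
  by move: w2D; rewrite -apb e0 w20 addn0 => <-.
have G1 : geodesic_seq a p w1 by [].
have G2 : geodesic_seq p b w2 by [].
move=> i j ij jD; rewrite /w; have [jp|pj] := leqP j (D a p).
  by rewrite (leq_trans ij jp) h1.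
have jD2 : (j - D a p <= D p b)%N by move: jD; rewrite -apb; lia.
have [ip|pi] := leqP i (D a p); last by rewrite h2//; lia.
have [i1 i2] := geodesic_seq_btw G1 ip.
have [j1 j2] := geodesic_seq_btw G2 jD2.
have [_ iapb] := btw_left apb i1; have [_ ipj] := btw_right iapb j1.
by rewrite -ipj j2; move: i1 ij pj ip; rewrite /btw i2; lia.
Qed.

(** The configuration behind the detour: [p] is the projection of [x] to the
    interval from [o] to [z], the geodesic from [p] to [e] is a part of this
    interval, and [u] lies above [p] in the direction of both [x] and [y]. *)
Section Detour.
Variables o x y z u c : V.
Let p := m o x z.
Let e := m p y z.
Let v := m u y z.
Hypotheses (puw : btw p u (m p x y)) (pce : btw p c e) (hu : (D p u <= D p e)%N).

Let opx : btw o p x. Proof. by have [] := med_btw o x z. Qed.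
Let xpz : btw x p z. Proof. by have [] := med_btw o x z. Qed.
Let opz : btw o p z. Proof. by have [] := med_btw o x z. Qed.
Let pux : btw p u x.
Proof. by have [h _ _] := med_btw p x y; have [] := btw_left h puw. Qed.
Let puy : btw p u y.
Proof. by have [_ _ h] := med_btw p x y; have [] := btw_left h puw. Qed.
Let opu : btw o p u. Proof. by have [] := btw_right opx pux. Qed.
Let zpu : btw z p u. Proof. by have [] := btw_right (btw_sym xpz) pux. Qed.
Let yvz : btw y v z. Proof. by have [] := med_btw u y z. Qed.
Let uvz : btw u v z. Proof. by have [] := med_btw u y z. Qed.
Let puv : btw p u v.
Proof. by have [h _ _] := med_btw u y z; have [] := btw_right puy h. Qed.
Let pcz : btw p c z.
Proof. by have [_ _ h] := med_btw p y z; have [] := btw_left h pce. Qed.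

Let gate_opt t : btw u t z -> btw o p t.
Proof.
move=> utz; have -> : p = m u z o.
  by apply: med_unique; [exact: btw_sym|exact: btw_sym|exact: btw_sym].
exact: median_gate.
Qed.

Let gate_yz s t : btw y t z -> btw s (m s y z) t.
Proof. by rewrite -med_rot; exact: median_gate. Qed.

Let past_v t : btw v t z -> btw y t z.
Proof. by move=> vtz; have [] := btw_right yvz vtz. Qed.

Let spz s : btw p s u -> btw s p z.
Proof. by move=> psu; apply: btw_sym; have [] := btw_right zpu psu. Qed.

(** Project to the interval from [p] to [z]: this sends [s] to [p], and [t] to a point
    between [y] and [z], which is seen from [p] through the gate [e]. *)
Let far_sides s t : btw p s u -> btw v t z -> (D p e <= D s t)%N.
Proof.
move=> psu vtz; pose t' := m p z t.
have [pt'z zt't _] := med_btw p z t; rewrite -/t' in pt'z zt't.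
have [yt'z _] := btw_right (past_v vtz) (btw_sym zt't).
have /gate_yz := yt'z; move=> /(_ p); rewrite -/e => pet'.
have ps : p = m p z s.
  by apply: med_unique; [exact: btwxx|exact/btw_sym/spz|exact: btwxx].
have := median_lipschitz p z s t; rewrite -ps -/t'; move: pet'; rewrite /btw; lia.
Qed.

(** Across the top the path is geodesic. Once it comes down, the distance to the
    climbing side is at least the width D p e, which bounds the climb and half the
    crossing; the triangle inequality bounds the descent, and 1 + 2 + (3 + 1) = 7. *)
Let cross_up s t : btw p s u -> btw u t v \/ btw v t z ->
  (D s u + D u t <= 7 * D s t)%N.
Proof.
move=> psu [utv|vtz].
  have [_ put] := btw_right puv utv; have [_ sut] := btw_left put psu.
  by move: sut; rewrite /btw; lia.
have far := far_sides psu vtz.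
have [_ yez _] := med_btw p y z; rewrite -/e in yez.
have uve : btw u v e by apply: gate_yz.
have [_ uvt] := btw_right uvz vtz.
have := mg_tri u p e; have := mg_tri v u t; have := mg_tri u s t.
rewrite (mg_distC u p) (mg_distC v u) (mg_distC u s).
by move: far uve uvt psu hu; rewrite /btw; clear; lia.
Qed.

Let cross s t : btw o s p \/ btw p s u -> btw u t v \/ btw v t z ->
  (D s u + D u t <= 7 * D s t)%N.
Proof.
move=> [osp|psu] tE; last exact: cross_up.
have utz : btw u t z.
  by case: tE => h; [have [] := btw_left uvz h|have [] := btw_right uvz h].
have := cross_up (btwxx p u) tE; have [_ spt] := btw_left (gate_opt utz) osp.
by have [_] := btw_left opu osp; move: spt; rewrite /btw; lia.
Qed.

Let avoid_up s : btw o s p \/ btw p s u -> (D p c <= D s c)%N.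
Proof.
move=> h; suff : btw s p z.
  by move=> /btw_right/(_ pcz)[_]; rewrite /btw; lia.
case: h => [osp|]; last exact: spz.
by have [_] := btw_left opz osp.
Qed.

Let avoid_across t : btw u t v \/ btw v t z ->
  (minn (D p u) (D c e) <= D t c)%N.
Proof.
move=> [utv|vtz].
  have [_ put] := btw_right puv utv.
  have ut : u = m p u t.
    by apply: med_unique => //; [exact/btw_sym/btwxx|exact: btwxx].
  have [_ upc] := btw_right (btw_sym zpu) pcz.
  have pc : p = m p u c by apply: med_unique => //; exact: btwxx.
  have := median_lipschitz p u t c; rewrite -ut -pc (mg_distC u p); lia.
have /gate_yz := past_v vtz; move=> /(_ p); rewrite -/e => pet.
have [_ cet] := btw_left pet pce.
by move: cet; rewrite /btw (mg_distC t c); lia.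
Qed.

(** The detour climbs from [p] to [u], crosses over to [v] and comes down to [z]. *)
Lemma median_detour : exists S w, [/\ w 0%N = o, w S = z,
  forall i, (i < S)%N -> (D (w i) (w i.+1) <= 1)%N,
  forall i j, (i <= j)%N -> (j <= S)%N -> (j - i <= 7 * D (w i) (w j))%N &
  forall i, (i <= S)%N -> (minn (D p u) (minn (D p c) (D c e)) <= D (w i) c)%N].
Proof.
have [g1 G1 g1p] := geodesic_seq_through opu.
have [g2 G2 g2v] := geodesic_seq_through uvz.
have [g10 g1D h1] := G1; have [g20 g2D h2] := G2.
have up i : (i <= D o u)%N -> btw o (g1 i) p \/ btw p (g1 i) u.
  move=> iD; have [ip|pi] := leqP i (D o p).
    left; move: (h1 _ _ (leq0n _) iD) (h1 _ _ ip (leq_trans (leq_addr _ _) (eq_leq opu))).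
    by rewrite g10 g1p /btw; lia.
  right; move: (h1 _ _ (ltnW pi) iD) (h1 _ _ iD (leqnn _)).
  by rewrite g1p g1D /btw; move: opu pi; rewrite /btw; lia.
have across j : (j <= D u z)%N -> btw u (g2 j) v \/ btw v (g2 j) z.
  move=> jD; have [jv|vj] := leqP j (D u v).
    left; move: (h2 _ _ (leq0n _) jD) (h2 _ _ jv (leq_trans (leq_addr _ _) (eq_leq uvz))).
    by rewrite g20 g2v /btw; lia.
  right; move: (h2 _ _ (ltnW vj) jD) (h2 _ _ jD (leqnn _)).
  by rewrite g2v g2D /btw; move: uvz vj; rewrite /btw; lia.
pose w i := if (i < D o u)%N then g1 i else g2 (i - D o u)%N.
have w1 i : (i <= D o u)%N -> w i = g1 i.
  by rewrite /w leq_eqVlt => /orP[/eqP->|->//]; rewrite ltnn subnn g1D.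
have w2 i : (D o u <= i)%N -> w i = g2 (i - D o u)%N by rewrite /w ltnNge => ->.
exists (D o u + D u z)%N, w; split.
- by rewrite w1.
- by rewrite w2 ?leq_addr// addKn.
- move=> i iS; have [iu|ui] := ltnP i (D o u).
    by rewrite !w1// ?(ltnW iu)// h1// subSnn.
  rewrite !w2// ?(leq_trans ui)// subSn// h2//; first by rewrite subSnn.
  by lia.
- move=> i j ij jS; have [ju|uj] := leqP j (D o u).
    by rewrite !w1// ?(leq_trans ij)// h1//; lia.
  have jD : (j - D o u <= D u z)%N by lia.
  rewrite (w2 j) ?(ltnW uj)//; have [iu|ui] := leqP i (D o u).
    rewrite w1//; have := cross (up i iu) (across _ jD).
    have [_] := geodesic_seq_btw G1 iu; have [+ _] := geodesic_seq_btw G1 iu.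
    have [_ ->] := geodesic_seq_btw G2 jD; rewrite /btw.
    by move: ij uj iu; clear; lia.
  by rewrite w2 ?(ltnW ui)// h2//; lia.
- move=> i iS; have [iu|ui] := leqP i (D o u).
    by rewrite w1//; have := avoid_up (up i iu); lia.
  rewrite w2 ?(ltnW ui)//; have := @avoid_across (g2 (i - D o u)%N) (across _ _).
  lia.
Qed.

End Detour.
End MedianGraph.

(** * Median graphs from cube complexes *)

Section CubeComplexMedianGraph.
Context {R : realType} (Q : cube_complex R) (mQ : Q -> Q -> Q -> Q).
Hypothesis mQ_median : cc_median mQ.

Lemma cc_adjacent_sym (p q : Q) : cc_adjacent p q -> cc_adjacent q p.
Proof.
move=> [c [x [y [cx cy card1 xp yq]]]]; exists c, y, x; split=> //.
by apply: etrans card1; apply: eq_card => i; rewrite !inE eq_sym.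
Qed.

Lemma cc_adjacent_vertex (p q : Q) : cc_adjacent p q -> cc_vertex p /\ cc_vertex q.
Proof. by move=> [c [x [y [cx cy _ xp yq]]]]; split; [exists c, x|exists c, y]. Qed.

Lemma edge_path_sub (a b : Q) n w i j : edge_path a b n w -> (i <= j)%N -> (j <= n)%N ->
  edge_path (w i) (w j) (j - i) (fun l => w (i + l)%N).
Proof.
move=> [_ _ adj] ij jn; split; rewrite ?addn0 ?subnKC// => l lji.
by rewrite addnS; apply: adj; lia.
Qed.

Lemma edge_path_rev (a b : Q) n w : edge_path a b n w ->
  edge_path b a n (fun i => w (n - i)%N).
Proof.
move=> [w0 wn adj]; split; rewrite ?subn0 ?subnn// => i i_n.
apply: cc_adjacent_sym; have -> : (n - i = (n - i.+1).+1)%N by lia.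
by apply: adj; lia.
Qed.

Lemma edge_path_cat (a b c : Q) n1 w1 n2 w2 :
  edge_path a b n1 w1 -> edge_path b c n2 w2 ->
  edge_path a c (n1 + n2) (fun i => if (i <= n1)%N then w1 i else w2 (i - n1)%N).
Proof.
move=> [w10 w1n adj1] [w20 w2n adj2]; split=> [//||i i_n].
  case: leqP => h; last by rewrite addKn.
  have n20 : n2 = 0%N by lia.
  by rewrite n20 addn0 w1n -w20 -w2n n20.
have [h|h] := ltnP i n1; first by rewrite (ltnW h); exact: adj1.
have [e|ne] := eqVneq i n1.
  by rewrite e leqnn subSnn w1n -w20; apply: adj2; lia.
by rewrite leqNgt ltn_neqAle eq_sym ne h/= subSn//; apply: adj2; lia.
Qed.

Lemma edge_path_vertex (a b : Q) n w i : cc_vertex a -> edge_path a b n w ->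
  (i <= n)%N -> cc_vertex (w i).
Proof.
move=> va [w0 _ adj]; case: i => [|i] i_n; first by rewrite w0.
by have [] := cc_adjacent_vertex (adj i i_n).
Qed.

(** The graph is connected because a median of [a], [b], [b] lies on a geodesic from
    [a] to [b]. *)
Lemma comb_geodesic_ex (a b : Q) : cc_vertex a -> cc_vertex b ->
  exists n, comb_dist a b n.
Proof.
move=> va vb; have [/(_ erefl) [_ [n [w [i [h _ _]]]] _ _] _] :=
  mQ_median va vb vb (mQ a b b).
by exists n, w.
Qed.

Definition cc_vertices := {p : Q | cc_vertex p}.

Definition cc_vdist (a b : cc_vertices) : nat :=
  projT1 (cid (comb_geodesic_ex (svalP a) (svalP b))).

Lemma cc_vdistP (a b : cc_vertices) : comb_dist (sval a) (sval b) (cc_vdist a b).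
Proof. by rewrite /cc_vdist; case: cid. Qed.

Lemma cc_vdist_le (a b : cc_vertices) n w : edge_path (sval a) (sval b) n w ->
  (cc_vdist a b <= n)%N.
Proof. by have [w' [_ h]] := cc_vdistP a b; exact: h. Qed.

Lemma comb_geodesicE (a b : cc_vertices) n w :
  comb_geodesic (sval a) (sval b) n w -> n = cc_vdist a b.
Proof.
move=> [pw h]; apply/eqP; rewrite eqn_leq (cc_vdist_le pw) andbT.
by have [w' [pw' _]] := cc_vdistP a b; exact: h pw'.
Qed.

Lemma cc_vdistxx a : cc_vdist a a = 0%N.
Proof.
apply/eqP; rewrite -leqn0; apply: (@cc_vdist_le _ _ 0 (fun=> sval a)).
by split.
Qed.

Lemma cc_vdistC a b : cc_vdist a b = cc_vdist b a.
Proof.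
suff h x y : (cc_vdist x y <= cc_vdist y x)%N by apply/eqP; rewrite eqn_leq !h.
by have [w [pw _]] := cc_vdistP y x; apply: cc_vdist_le (edge_path_rev pw).
Qed.

Lemma cc_vdist_tri a b c : (cc_vdist a c <= cc_vdist a b + cc_vdist b c)%N.
Proof.
have [w [pw _]] := cc_vdistP a b; have [w' [pw' _]] := cc_vdistP b c.
exact: cc_vdist_le (edge_path_cat pw pw').
Qed.

Lemma cc_vdist_geo a b : exists w : nat -> cc_vertices,
  [/\ w 0%N = a, w (cc_vdist a b) = b &
      forall i j, (i <= j)%N -> (j <= cc_vdist a b)%N -> cc_vdist (w i) (w j) = (j - i)%N].
Proof.
have [w [pw _]] := cc_vdistP a b; set n := cc_vdist a b in pw *.
have [w0 wn _] := pw.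
have /choice[u hu] : forall i, exists v : cc_vertices, (i <= n)%N -> sval v = w i.
  move=> i; have [i_n|n_i] := leqP i n; last by exists a.
  by exists (exist _ (w i) (edge_path_vertex (svalP a) pw i_n)).
have eq_vert (x y : cc_vertices) : sval x = sval y -> x = y.
  by case: x y => [x vx] [y vy] /= e; subst; congr exist; exact: Prop_irrelevance.
exists u; split; [by apply: eq_vert; rewrite hu|by apply: eq_vert; rewrite hu|].
have sub i j : (i <= j)%N -> (j <= n)%N -> (cc_vdist (u i) (u j) <= j - i)%N.
  move=> ij jn; apply: cc_vdist_le; rewrite (hu i) ?(leq_trans ij)// (hu j)//.
  exact: edge_path_sub pw ij jn.
have u0 : u 0%N = a by apply: eq_vert; rewrite hu.
have un : u n = b by apply: eq_vert; rewrite hu.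
move=> i j ij jn; apply/eqP; rewrite eqn_leq sub//=.
have := sub 0%N i (leq0n _) (leq_trans ij jn); have := sub j n jn (leqnn _).
rewrite u0 un; have := cc_vdist_tri a (u i) b; have := cc_vdist_tri (u i) (u j) b.
rewrite -/n; lia.
Qed.

Lemma on_comb_geodesicP (a b p : cc_vertices) :
  on_comb_geodesic (sval a) (sval b) (sval p) <->
  (cc_vdist a p + cc_vdist p b = cc_vdist a b)%N.
Proof.
split=> [[n [w [i [gw i_n wi]]]]|e].
  have nE := comb_geodesicE gw; have [pw _] := gw; have [w0 wn _] := pw.
  have := edge_path_sub pw (leq0n i) i_n; have := edge_path_sub pw i_n (leqnn n).
  rewrite w0 wn wi subn0 => /cc_vdist_le h1 /cc_vdist_le h2.
  have := cc_vdist_tri a p b; lia.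
have [w1 [p1 _]] := cc_vdistP a p; have [w2 [p2 _]] := cc_vdistP p b.
have pw := edge_path_cat p1 p2; rewrite e in pw.
eexists _, _, (cc_vdist a p); split; first split; first exact: pw.
- by have [w' [_ h]] := cc_vdistP a b.
- by rewrite -e leq_addr.
- by have [_ w1n _] := p1; rewrite leqnn.
Qed.

Lemma cc_median_vertex (a b c : cc_vertices) : cc_vertex (mQ (sval a) (sval b) (sval c)).
Proof.
by have [/(_ erefl)[]] := mQ_median (svalP a) (svalP b) (svalP c) (mQ (sval a) (sval b) (sval c)).
Qed.

Definition cc_vmed (a b c : cc_vertices) : cc_vertices := exist _ _ (cc_median_vertex a b c).

Lemma cc_vmedP (a b c p : cc_vertices) :
  [/\ cc_vdist a p + cc_vdist p b = cc_vdist a b, cc_vdist b p + cc_vdist p c = cc_vdist b c &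
      cc_vdist a p + cc_vdist p c = cc_vdist a c]%N <-> p = cc_vmed a b c.
Proof.
have [h1 h2] := mQ_median (svalP a) (svalP b) (svalP c) (sval p).
split=> [[/on_comb_geodesicP k1 /on_comb_geodesicP k2 /on_comb_geodesicP k3]|pE].
  have e : sval p = sval (cc_vmed a b c) by apply: h2; split=> //; exact: svalP.
  case: p e {h1 h2 k1 k2 k3} => p vp /= e; rewrite /cc_vmed.
  by move: (cc_median_vertex _ _ _) => vm; subst; congr exist; exact: Prop_irrelevance.
have [|_ k1 k2 k3] := h1; first by rewrite pE.
by split; apply/on_comb_geodesicP.
Qed.

Definition cc_median_graph : median_graph :=
  MedianGraph cc_vdistxx cc_vdistC cc_vdist_tri cc_vdist_geo cc_vmedP.

End CubeComplexMedianGraph.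

(** * Median models of four points *)

Section Models.
Context {R : realType} {X : metricType R}.
Local Notation "'d'" := (@mdist R X).

(** A quasi-isometrically embedded median graph that comes close to four given
    points; four is the number of points of the detour configuration. *)
Record median_model (m : X -> X -> X -> X) (K : R) (o x y z : X) := MedianModel {
  mm_graph : median_graph;
  mm_map : mg_vertex mm_graph -> X;
  mm_pts : mm_graph * mm_graph * mm_graph * mm_graph;
  mm_qi : forall a b, (mg_dist a b)%:R / K - K <= d (mm_map a) (mm_map b) <= K * (mg_dist a b)%:R + K;
  mm_med : forall a b c, d (mm_map (mg_med a b c)) (m (mm_map a) (mm_map b) (mm_map c)) <= K;
  mm_near : [/\ d (mm_map mm_pts.1.1.1) o <= K, d (mm_map mm_pts.1.1.2) x <= K,
    d (mm_map mm_pts.1.2) y <= K & d (mm_map mm_pts.2) z <= K] }.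

(** The hull consists of medians only, so [x] itself is approached by iterating the
    map that sends [y] to [m y y y]. *)
Lemma median_hull_near (m : X -> X -> X -> X) (e : R) (A : set X) x n :
  (forall x, d (m x x x) x <= e) -> A x ->
  exists2 y, median_hull m n A y & d x y <= n%:R * e.
Proof.
move=> me Ax; elim: n => [|n [y hy xy]].
  by exists x => //; rewrite mdistxx mul0r.
exists (m y y y).
  by exists y => //; exists y => //; exists y.
rewrite -natr1 mulrDl mul1r; apply: (le_trans (mdist_tri x y _)).
by apply: lerD => //; rewrite mdistC.
Qed.

(** Medians of a single vertex are trivial in the cube complex that approximates the
    singleton of [x]. *)
Lemma coarse_median_idem m h v : coarse_median_of_rank (R := R) (X := X) m h v ->
  exists e : R, forall x, d (m x x x) x <= e.
Proof.
move=> [lip fin]; set H : R := (h 1%N)%:R.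
exists (H * (H + H + H) + H + H) => x.
have [|Q [mQ [f [g [[_ _ _ med] [vg am close]]]]]] := fin 1%N [fset x]%fset.
  by rewrite cardfs1.
have xin : x \in [fset x]%fset by rewrite inE.
have vgx := vg x xin; have cx := close x xin; rewrite -/H in cx.
have gE : mQ (g x) (g x) (g x) = g x.
  have on : on_comb_geodesic (g x) (g x) (g x).
    by exists 0%N, (fun=> g x), 0%N.
  by apply/esym; apply: (med _ _ _ vgx vgx vgx (g x)).2.
have := am _ _ _ vgx vgx vgx; rewrite gE -/H => h1.
have := lip x x x (f (g x)) (f (g x)) (f (g x)); rewrite -/H => h2.
have h3 : H * (d x (f (g x)) + d x (f (g x)) + d x (f (g x))) <= H * (H + H + H).
  by rewrite ler_wpM2l// !lerD.
have := mdist_tri (m x x x) (m (f (g x)) (f (g x)) (f (g x))) x.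
have := mdist_tri (m (f (g x)) (f (g x)) (f (g x))) (f (g x)) x.
by move: h1; rewrite (mdistC (f _) (m _ _ _)) (mdistC (f _) x); lra.
Qed.

(** The constants depend on the number of distinct points among [o], [x], [y], [z]
    only, hence are bounded by their maximum over the numbers up to four. *)
Lemma LQC_median_models : LQC X -> exists (m : X -> X -> X -> X) (H K : R),
  [/\ 0 <= H, 1 <= K,
    forall x y z x' y' z', d (m x y z) (m x' y' z') <= H * (d x x' + d y y' + d z z') &
    forall o x y z, inhabited (median_model m K o x y z)].
Proof.
move=> [m [h [v [_ cm [K hK]]]]]; have [lip _] := cm.
have [e he] := coarse_median_idem cm.
have [B hB] := bounded_initial K 4.
exists m, (h 1%N)%:R, (Num.max 1 (B + v%:R * e)); split=> // [|o x y z].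
  by rewrite le_max lexx.
have e0 : 0 <= e := le_trans (mdist_nneg _ _) (he o).
have ve : 0 <= v%:R * e by rewrite mulr_ge0.
set K' := Num.max _ _; pose F := [fset p in [:: o; x; y; z]]%fset.
have FN : F != fset0 by apply/fset0Pn; exists o; rewrite !inE eqxx.
have F4 : (#|` F| <= 4)%N by rewrite card_fseq; exact: size_undup.
have [Q [mQ [f [[_ _ med] [am [[k1 _] _ qi dense]]]]]] := hK F FN.
set k := K #|` F| in am k1 qi dense.
have kB : k <= B by exact: hB.
have BK : B + v%:R * e <= K' by rewrite le_max lexx orbT.
have kK : k <= K' by lra.
have k0 : 0 < k by apply: lt_le_trans k1.
have near p : p \in F -> exists a : cc_median_graph med, d (f (sval a)) p <= K'.
  move=> pF; have [p' hp' pp'] := median_hull_near v he (pF : [set` F] p).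
  have [a va ap'] := dense p' hp'; exists (exist _ a va) => /=.
  by have := mdist_tri (f a) p' p; rewrite (mdistC p' p); lra.
have [|o' ho] := near o; first by rewrite !inE eqxx.
have [|x' hx] := near x; first by rewrite !inE eqxx ?orbT.
have [|y' hy] := near y; first by rewrite !inE eqxx ?orbT.
have [|z' hz] := near z; first by rewrite !inE eqxx ?orbT.
constructor; apply: (@MedianModel m K' o x y z (cc_median_graph med) (f \o sval) (o', x', y', z')).
- move=> a b /=; have /andP[q1 q2] := qi _ _ _ (svalP a) (svalP b) (cc_vdistP med a b).
  apply/andP; split.
    apply: le_trans q1; apply: lerB => //; rewrite ler_wpM2l// lef_pV2// posrE.
    exact: lt_le_trans kK.
  by apply: (le_trans q2); apply: lerD => //; rewrite ler_wpM2r.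
- by move=> a b c; apply: le_trans kK; apply: am; exact: svalP.
- by split.
Qed.

End Models.

(** * The projection to the ray *)

Section Projection.
Context {R : realType} {X : metricType R} (o : X) (kappa : R -> R) (q : R -> X) (a : R).
Hypotheses (kappa_sublin : sublinear kappa) (a1 : 1 <= a) (q0 : q 0 = o).
Hypothesis q_coarse : forall T, coarse_path a 0 T q.
Hypotheses (X_proper : proper_space X) (geo : geodesic_space (@mdist R X)) (lqc : LQC X).

Local Notation "'d'" := (@mdist R X).
Local Notation k := (kappa_at o kappa).
Local Notation Z := (q @` `[0, +oo[).
Local Notation dZ x := (dist_to x Z).
Hypothesis returning : Morse_for_returning_rays o kappa Z.

(** Limits along an ultrafilter exist by properness, and any two of them are
    approximated simultaneously at arbitrarily large indices. *)
Lemma ultralimit (F : X -> nat -> X) :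
  (forall x, exists B, forall n, d o (F x n) <= B) ->
  exists p : X -> X, forall x y (T : nat), exists n, [/\ (T <= n)%N,
    d (p x) (F x n) <= 1 & d (p y) (F y n) <= 1].
Proof.
move=> bnd; have [U [UU ooU]] := @ultraFilterLemma nat \oo _.
have /choice[p hp] : forall x, exists p, \forall n \near U, d p (F x n) <= 1.
  move=> x; have [B hB] := bnd x; have := @X_proper o B; rewrite compact_ultra => cpt.
  have UF : UltraFilter (F x @ U).
    apply: Build_UltraFilter => G PG sub; apply/seteqP; split=> A; last exact: sub.
    move=> GA; have [//|h] := in_ultra_setVsetC (F x @^-1` A) UU.
    have : G (A `&` ~` A) by apply: filterI GA (sub (~` A) h).
    by rewrite setICr => G0; case: (@filter_not_empty _ G PG G0).
  have [|p [_ Fp]] := cpt (F x @ U) UF.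
    by have : \forall n \near U, d o (F x n) <= B by apply: filterE => n; exact: hB.
  exists p; have := (@metricType_numDomainType.cvgrPdist_le R X _ U _ (F x) p).1 Fp.
  by apply.
exists p => x y T; have UT : \forall n \near U, (T <= n)%N by apply: ooU; exact: nbhs_infty_ge.
have [n [[h1 h2] h3]] := filter_ex (filterI (filterI (hp x) (hp y)) UT).
by exists n.
Qed.

(** A median model of [o], [x], [y] and a far point of [q] in which [p x] and
    [p y] are medians, and all of whose uniform quasi-geodesics from [o] to the far
    point stay near [q] inside the ball of radius [B], and conversely. *)
Record tracked_model (p : X -> X) (K M B : R) (x y : X) := TrackedModel {
  tm_graph : median_graph;
  tm_map : tm_graph -> X;
  tm_o : tm_graph; tm_x : tm_graph; tm_y : tm_graph; tm_z : tm_graph;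
  tm_qi : forall u v, (mg_dist u v)%:R / K - K <= d (tm_map u) (tm_map v) <= K * (mg_dist u v)%:R + K;
  tm_near : [/\ d (tm_map tm_o) o <= K, d (tm_map tm_x) x <= K & d (tm_map tm_y) y <= K];
  tm_proj : d (tm_map (mg_med tm_o tm_x tm_z)) (p x) <= K /\
            d (tm_map (mg_med tm_o tm_y tm_z)) (p y) <= K;
  tm_track : forall S w, w 0%N = tm_o -> w S = tm_z ->
    (forall i, (i < S)%N -> (mg_dist (w i) (w i.+1) <= 1)%N) ->
    (forall i j, (i <= j)%N -> (j <= S)%N -> (j - i <= 7 * mg_dist (w i) (w j))%N) ->
    (forall i, (i <= S)%N -> d (tm_map (w i)) o <= B ->
       dZ (tm_map (w i)) <= M * k (tm_map (w i))) /\
    (forall t, 0 <= t -> d (q t) o <= B ->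
       exists2 i, (i <= S)%N & d (q t) (tm_map (w i)) <= M * k (q t)) }.

Lemma tracked_models : exists p K M, [/\ 1 <= K, 1 <= M &
  forall x y B, 0 <= B -> inhabited (tracked_model p K M B x y)].
Proof.
have [m [H [K [H0 K1 lip models]]]] := LQC_median_models lqc.
have K0 : 0 <= K by apply: le_trans K1.
have HK0 : 0 <= H * (3 * K) by rewrite !mulr_ge0.
have near_med x y z (mm : median_model m K o x y z) :
    let: (o', x', y', z') := mm_pts mm in
    d (mm_map (mg_med o' x' z')) (m o x z) <= K + H * (3 * K) /\
    d (mm_map (mg_med o' y' z')) (m o y z) <= K + H * (3 * K).
  case: mm => V f [[[ o' x'] y'] z'] /= qi med [ho hx hy hz].
  have aux u' u : d (f u') u <= K -> d (f (mg_med o' u' z')) (m o u z) <= K + H * (3 * K).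
    move=> hu; apply: (le_trans (mdist_tri _ (m (f o') (f u') (f z')) _)).
    apply: lerD; first exact: med.
    by apply: (le_trans (lip _ _ _ _ _ _)); rewrite ler_wpM2l//; lra.
  by split; apply: aux.
have bnd x : exists B, forall n : nat, d o (m o x (q n%:R)) <= B.
  exists (K * (K * (d o x + 2 * K + K)) + K + K + (K + H * (3 * K))) => n.
  have [mm] := models o x x (q n%:R); have := near_med x x _ mm.
  case: mm => V f [[[ o' x'] y'] z'] /= qi med [ho hx _ hz] [h _].
  have /andP[_ qi1] := qi o' (mg_med o' x' z').
  have /andP[+ _] := qi o' x'; rewrite lerBlDr ler_pdivrMr; last by lra.
  move=> qi2; have [mb _ _] := med_btw o' x' z'.
  have lD : (mg_dist o' (mg_med o' x' z'))%:R <= (mg_dist o' x')%:R :> R.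
    by rewrite ler_nat; move: mb; rewrite /btw; lia.
  have dox : d (f o') (f x') <= d o x + 2 * K.
    have := mdist_tri (f o') o (f x'); have := mdist_tri o x (f x').
    by rewrite (mdistC x (f x')); lra.
  have qi3 : (mg_dist o' (mg_med o' x' z'))%:R <= K * (d o x + 2 * K + K).
    by apply: (le_trans lD); apply: (le_trans qi2); rewrite mulrC ler_wpM2l// lerD2r.
  have := ler_wpM2l K0 qi3.
  have := mdist_tri o (f o') (m o x (q n%:R)).
  have := mdist_tri (f o') (f (mg_med o' x' z')) (m o x (q n%:R)).
  by rewrite (mdistC o (f o')); lra.
have [p hp] := ultralimit bnd.
pose K' := K + H * (3 * K) + 1.
have K'1 : 1 <= K' by rewrite /K'; lra.
have KK' : K <= K' by rewrite /K'; lra.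
(* 7 is the constant of the detour, and the map to [X] costs another [K']. *)
have K'7 : 1 <= 7 * K' by lra.
have [M M1 test] := test_paths kappa_sublin a1 q0 q_coarse geo returning K'7.
exists p, K', M; split=> // x y B B0.
have [T0 hT0] := test B B0; have [n [T0n px py]] := hp x y T0.
have [mm] := models o x y (q n%:R); have := near_med x y _ mm.
case: mm => V f [[[ o' x'] y'] z'] /= qi med [ho hx hy hz] [hpx hpy].
have Kp : 0 < K by lra.
have qi' u v : (mg_dist u v)%:R / K' - K' <= d (f u) (f v) <= K' * (mg_dist u v)%:R + K'.
  have /andP[h1 h2] := qi u v; apply/andP; split.
    apply: le_trans h1; apply: lerB => //; rewrite ler_wpM2l// lef_pV2// posrE; lra.
  by apply: (le_trans h2); apply: lerD => //; rewrite ler_wpM2r.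
constructor; apply: (@TrackedModel p K' M B x y V f o' x' y' z') => //.
- by split; lra.
- have := mdist_tri (f (mg_med o' x' z')) (m o x (q n%:R)) (p x).
  have := mdist_tri (f (mg_med o' y' z')) (m o y (q n%:R)) (p y).
  by rewrite (mdistC (m o x _) (p x)) (mdistC (m o y _) (p y)) /K'; split; lra.
move=> S w w0 wS steps low; apply: (hT0 n S (f \o w)) => //=; last 2 first.
- by rewrite w0; lra.
- by rewrite wS; lra.
split=> [i iS|i j ij jS] /=.
  have /andP[_ /le_trans] := qi' (w i) (w i.+1); apply.
  have : (mg_dist (w i) (w i.+1))%:R <= 1 :> R by rewrite (ler_nat R _ 1) steps.
  by move=> /(ler_wpM2l (le_trans ler01 K'1)); lra.
have /andP[+ _] := qi' (w i) (w j); have := low i j ij jS.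
rewrite -(ler_nat R) natrM !lerBlDr !ler_pdivrMr; try lra.
move=> h1 h2; apply: (le_trans h1).
have K'K' : 0 <= K' * K' by rewrite mulr_ge0//; lra.
by lra.
Qed.

End Projection.

(** * Estimates for the projection *)

Section ProjectionEstimates.
Context {R : realType} {X : metricType R} (o : X) (kappa : R -> R) (q : R -> X).
Hypotheses (kappa_sublin : sublinear kappa) (q0 : q 0 = o).
Variables (p : X -> X) (K M : R).
Hypotheses (K1 : 1 <= K) (M1 : 1 <= M).

Local Notation "'d'" := (@mdist R X).
Local Notation k := (kappa_at o kappa).
Local Notation Z := (q @` `[0, +oo[).
Local Notation dZ x := (dist_to x Z).
Local Notation model := (tracked_model o kappa q p K M).
Hypothesis models : forall x y B, 0 <= B -> inhabited (model B x y).

Let K0 : 0 <= K. Proof. exact: le_trans K1. Qed.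
Let M0 : 0 <= M. Proof. exact: le_trans M1. Qed.
Let Zn0 : Z !=set0. Proof. by exists (q 0); exact: image_ray. Qed.
Let Zo : Z o. Proof. by rewrite -q0; exact: image_ray. Qed.

Section OneModel.
Variables (x y : X) (B : R) (tm : model B x y).
Local Notation f := (@tm_map _ _ _ _ _ _ _ _ _ _ _ tm).
Local Notation "'D'" := (@mg_dist (tm_graph tm)).
Local Notation o' := (tm_o tm).
Local Notation x' := (tm_x tm).
Local Notation y' := (tm_y tm).
Local Notation z' := (tm_z tm).

Lemma tm_upper u v : d (f u) (f v) <= K * (D u v)%:R + K.
Proof. by have /andP[] := tm_qi u v. Qed.

Lemma tm_lower u v : (D u v)%:R <= K * (d (f u) (f v) + K).
Proof.
have /andP[+ _] := tm_qi u v; rewrite lerBlDr ler_pdivrMr ?(lt_le_trans ltr01 K1)//.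
by rewrite mulrC.
Qed.

Lemma tm_lower_near u v s t : d (f u) s <= K -> d (f v) t <= K ->
  (D u v)%:R <= K * (d s t + 3 * K).
Proof.
move=> us vt; apply: (le_trans (tm_lower u v)); rewrite ler_wpM2l//.
have := mdist_tri (f u) s (f v); have := mdist_tri s t (f v).
by rewrite (mdistC t (f v)); lra.
Qed.

Lemma tm_ox : (D o' x')%:R <= K * (d x o + 3 * K).
Proof. by rewrite mdistC; have [ho hx _] := tm_near tm; exact: tm_lower_near. Qed.

Lemma tm_oy : (D o' y')%:R <= K * (d y o + 3 * K).
Proof. by rewrite mdistC; have [ho _ hy] := tm_near tm; exact: tm_lower_near. Qed.

Lemma tm_xy : (D x' y')%:R <= K * (d x y + 3 * K).
Proof. by have [_ hx hy] := tm_near tm; exact: tm_lower_near. Qed.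

Lemma tm_norm u : d (f u) o <= K * (D o' u)%:R + 2 * K.
Proof.
have [ho _ _] := tm_near tm; have := tm_upper o' u.
by have := mdist_tri (f u) (f o') o; rewrite (mdistC (f u) (f o')); lra.
Qed.

Lemma tm_geodesic c : btw o' c z' ->
  (d (f c) o <= B -> dZ (f c) <= M * k (f c)) /\
  (forall t, 0 <= t -> d (q t) o <= B ->
     exists2 u, btw o' u z' & d (q t) (f u) <= M * k (q t)).
Proof.
move=> ocz; have [w gw wc] := geodesic_seq_through ocz; have [w0 wz h] := gw.
have [|i j ij jS|near onto] := tm_track w0 wz.
- by move=> i iS; rewrite h// subSnn.
- by rewrite h//; lia.
split; first by rewrite -wc; apply: near; rewrite -ocz leq_addr.
move=> t t0 qt; have [i iS hi] := onto t t0 qt; exists (w i) => //.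
by have [] := geodesic_seq_btw gw iS.
Qed.

(** If the projections of [x] and [y] in the model were far apart and [x], [y]
    were far above them, then the detour would avoid a point of a geodesic from [o]
    to the far point by a large distance, although both are close to [q]. *)
Lemma model_dichotomy (b E : R) : 0 <= b ->
  (forall t, 0 <= t -> (M + 1) * kappa t <= t + E) -> B = 2 * b + E ->
  (forall u, (D o' u <= D o' x' + D x' y')%N -> d (f u) o <= b) ->
  let c := K * ((M + 1) * kappa b + M * kappa B + K) in
  let px := mg_med o' x' z' in
  (D px (mg_med px y' z'))%:R <= 2 * c + 1 \/ (D px x')%:R <= (D x' y')%:R + c.
Proof.
move=> b0 hE BE small c px; set e := mg_med px y' z'.
set w := mg_med px x' y'.
have [pw _ _] := med_btw px x' y'; rewrite -/w in pw.
have wxy : (D w x' <= D x' y')%N.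
  have := median_lipschitz px x' y' x'.
  rewrite -(med_unique (btw_sym (btwxx x' px)) (btwxx x' x') (btw_sym (btwxx x' px))).
  by rewrite (mg_distC y').
have [g1 [g10 g1D h1]] := mg_geo px w.
have [g2 [g20 g2D h2]] := mg_geo px e.
(* [cc] is the middle of a geodesic from [px] to [e]; the climb [hh] is kept below
   the length of this geodesic for the detour to be a uniform quasi-geodesic. *)
pose al := D px e; pose hh := minn al (D px w).
pose u := g1 hh; pose cc := g2 al./2.
have hhw : (hh <= D px w)%N by rewrite geq_minr.
have al2 : (al./2 <= D px e)%N by rewrite -/al; move: (al); clear; lia.
have puw : btw px u w.
  by have [] := geodesic_seq_btw (And3 g10 g1D h1) hhw.
have Dpu : D px u = hh by have [] := geodesic_seq_btw (And3 g10 g1D h1) hhw.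
have pce : btw px cc e.
  by have [] := geodesic_seq_btw (And3 g20 g2D h2) al2.
have Dpc : D px cc = al./2 by have [] := geodesic_seq_btw (And3 g20 g2D h2) al2.
have [|S [dw [dw0 dwz steps low avoid]]] := median_detour puw pce.
  by rewrite Dpu geq_minl.
have [opx _ opz] := med_btw o' x' z'; rewrite -/px in opx opz.
have [_ _ pez] := med_btw px y' z'; rewrite -/e in pez.
have [pcz _] := btw_left pez pce; have [ocz _] := btw_right opz pcz.
have [pep _] := med_triangle o' x' y' z'; rewrite -/px -/e in pep.
have lip := median_lipschitz o' z' x' y'; rewrite (med_swap o' x' z') (med_swap o' y' z') -/px in lip.
have fcb : d (f cc) o <= b.
  apply: small; apply: (leq_trans (mg_tri _ px _)); apply: leq_add.
    by rewrite -opx leq_addr.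
  by apply: leq_trans lip; apply: (@leq_trans (D px e)); [rewrite -pce|rewrite -pep]; exact: leq_addr.
have E0 : 0 <= kappa b by apply: sublinear_ge0.
have hEb := hE b b0; have BB : 2 * b + E <= B by rewrite BE.
have bB : b <= B.
  by rewrite BE; have := mulr_ge0 (addr_ge0 M0 ler01) E0; lra.
have [near _] := tm_geodesic ocz; have {}near := near (le_trans fcb bB).
have kb : k (f cc) <= kappa b by apply: sublinear_mono.
have [_ [t /= + <-] ht] := dist_to_near (f cc) Zn0 ltr01.
rewrite in_itv/= andbT => t0.
have ct : d (f cc) (q t) <= (M + 1) * kappa b.
  have k1 := kappa_at_ge1 o kappa_sublin (f cc).
  have := ler_wpM2l M0 kb; lra.
(* The radius [B] leaves room for the point [q t], which is only close to the ball of
   radius [b]. *)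
have qtB : d (q t) o <= B.
  have := mdist_tri (q t) (f cc) o; rewrite (mdistC (q t) (f cc)); lra.
have [_ /(_ t t0 qtB)[i iS hi]] := tm_track dw0 dwz steps low.
have kt : k (q t) <= kappa B by apply: sublinear_mono.
have Dc : (D (dw i) cc)%:R <= c.
  apply: (le_trans (tm_lower _ _)); rewrite /c ler_wpM2l// lerD2r.
  have := mdist_tri (f (dw i)) (q t) (f cc); have := ler_wpM2l M0 kt.
  by rewrite (mdistC (f (dw i)) (q t)) (mdistC (q t) (f cc)); lra.
have c0 : 0 <= c by apply: le_trans Dc.
have {avoid} := avoid i iS; rewrite Dpu Dpc => avoid.
have Dce : (al./2 <= D cc e)%N by move: pce; rewrite /btw Dpc -/al; move: (al) (D cc e); clear; lia.
have [h|h] : (al <= 2 * D (dw i) cc + 1)%N \/ (D px w <= D (dw i) cc)%N.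
  by move: avoid Dce; rewrite /hh; move: (al) (D cc e) (D px w) (D _ cc); clear; lia.
  left; have : (D px e)%:R <= (2 * D (dw i) cc + 1)%:R :> R by rewrite ler_nat.
  by rewrite natrD natrM; lra.
right; have : (D px x')%:R <= (D (dw i) cc + D x' y')%:R :> R.
  rewrite ler_nat; apply: (leq_trans (mg_tri _ w _)); exact: leq_add.
by rewrite natrD; lra.
Qed.

Definition tm_swap : model B y x := @TrackedModel _ _ _ _ _ _ _ _ _ _ _ _ f o' y' x' z'
  (@tm_qi _ _ _ _ _ _ _ _ _ _ _ tm)
  (let: And3 ho hx hy := tm_near tm in And3 ho hy hx)
  (let: conj hx hy := tm_proj tm in conj hy hx) (@tm_track _ _ _ _ _ _ _ _ _ _ _ tm).

End OneModel.

(** The dichotomy for the model and for the same model with [x] and [y] exchanged: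
    unless it bounds the gap between the projections on both sides, it bounds the
    distance from [x] to its projection by a multiple of that between [x] and [y]. *)
Lemma model_gap x y B (tm : model B x y) (b E : R) : 0 <= b ->
  (forall t, 0 <= t -> (M + 1) * kappa t <= t + E) -> B = 2 * b + E ->
  (forall u, (mg_dist (tm_o tm) u <= mg_dist (tm_o tm) (tm_x tm) +
     mg_dist (tm_x tm) (tm_y tm))%N -> d (tm_map u) o <= b) ->
  (forall u, (mg_dist (tm_o tm) u <= mg_dist (tm_o tm) (tm_y tm) +
     mg_dist (tm_y tm) (tm_x tm))%N -> d (tm_map u) o <= b) ->
  let c := K * ((M + 1) * kappa b + M * kappa B + K) in
  let px := mg_med (tm_o tm) (tm_x tm) (tm_z tm) in
  let py := mg_med (tm_o tm) (tm_y tm) (tm_z tm) in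
  (mg_dist px py)%:R <= 4 * c + 2 \/
  (mg_dist px (tm_x tm))%:R <= 3 * (mg_dist (tm_x tm) (tm_y tm))%:R + c.
Proof.
move=> b0 hE BE smallx smally; have := model_dichotomy b0 hE BE smallx.
have := @model_dichotomy _ _ _ (tm_swap tm) _ _ b0 hE BE smally.
rewrite /tm_swap/=; set px := mg_med (tm_o tm) (tm_x tm) (tm_z tm).
set py := mg_med (tm_o tm) (tm_y tm) (tm_z tm).
have [pep eE] := med_triangle (tm_o tm) (tm_x tm) (tm_y tm) (tm_z tm).
rewrite -/px -/py in pep eE; rewrite eE.
set c := K * _; set e := mg_med px (tm_y tm) (tm_z tm) in pep *.
have Dp : (mg_dist px py)%:R = (mg_dist px e)%:R + (mg_dist py e)%:R :> R.
  by rewrite -natrD (mg_distC py) pep.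
have Dxy : (mg_dist px py)%:R <= (mg_dist (tm_x tm) (tm_y tm))%:R :> R.
  have := median_lipschitz (tm_o tm) (tm_z tm) (tm_x tm) (tm_y tm).
  by rewrite (med_swap _ (tm_x tm)) (med_swap _ (tm_y tm)) ler_nat.
have Dxy0 : 0 <= (mg_dist (tm_x tm) (tm_y tm))%:R :> R by [].
have via : (mg_dist px (tm_x tm))%:R <= (mg_dist px py)%:R +
    (mg_dist py (tm_y tm))%:R + (mg_dist (tm_x tm) (tm_y tm))%:R :> R.
  rewrite -!natrD ler_nat (mg_distC (tm_x tm)).
  by apply: (leq_trans (mg_tri _ (tm_y tm) _)); rewrite leq_add2r mg_tri.
move=> [hy|hy] [hx|hx]; [left; lra|right; lra|right|right; lra].
by move: hy; rewrite (mg_distC (tm_y tm)); lra.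
Qed.
(** [p x] is near a median that lies on a geodesic of the model from [o] to the far
    point. *)
Lemma projection_near : exists2 C, 0 <= C & forall x, dZ (p x) <= C * k x.
Proof.
pose l := K * K; pose e := K * (K * (3 * K)) + 2 * K.
have l1 : 1 <= l by rewrite /l mulr_ege1.
have e0 : 0 <= e by rewrite /e addr_ge0// !mulr_ge0.
have ke := sublinear_ge0 kappa_sublin e0.
have l0 : 0 <= l + kappa e by lra.
exists (K + M * (l + kappa e)); first by rewrite addr_ge0 ?mulr_ge0.
move=> x; pose b := l * d x o + e.
have b0 : 0 <= b by rewrite addr_ge0// mulr_ge0// (le_trans ler01).
have [tm] := models x x b0.
have [opx _ opz] := med_btw (tm_o tm) (tm_x tm) (tm_z tm).
have [near _] := tm_geodesic opz.
have nb : d (tm_map (mg_med (tm_o tm) (tm_x tm) (tm_z tm))) o <= b.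
  apply: (le_trans (tm_norm _)).
  have : (mg_dist (tm_o tm) (mg_med (tm_o tm) (tm_x tm) (tm_z tm)))%:R <= K * (d x o + 3 * K).
    by apply: le_trans (tm_ox tm); rewrite ler_nat -opx leq_addr.
  by move=> /(ler_wpM2l K0); rewrite /b /l /e; lra.
have kb : k (tm_map (mg_med (tm_o tm) (tm_x tm) (tm_z tm))) <= (l + kappa e) * k x.
  apply: (@le_trans _ _ (kappa b)); first exact: sublinear_mono.
  exact: sublinear_affine.
have [px _] := tm_proj tm; have k1 := kappa_at_ge1 o kappa_sublin x.
have := near nb; have := ler_wpM2l M0 kb.
have := dist_to_lip (p x) (tm_map (mg_med (tm_o tm) (tm_x tm) (tm_z tm))) Zn0.
rewrite (mdistC (p x)).
have : 0 <= K * (k x - 1) by rewrite mulr_ge0 ?subr_ge0.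
lra.
Qed.

(** As [q] is close to geodesics of the models, points of [q] are almost fixed. *)
Lemma projection_fix : exists2 C, 0 <= C &
  forall t, 0 <= t -> d (p (q t)) (q t) <= C * k (q t).
Proof.
have KK : 0 <= K * (K * (2 * K + M)) by rewrite !mulr_ge0// addr_ge0// mulr_ge0.
have K0' := K0; have M0' := M0.
exists (2 * K + K * (K * (2 * K + M)) + M); first by lra.
move=> t t0; have [tm] := models (q t) (q t) (mdist_nneg (q t) o).
have [_ onto] := tm_geodesic (btwxx (tm_o tm) (tm_z tm)).
have [u ou hu] := onto t t0 (lexx _).
have k1 := kappa_at_ge1 o kappa_sublin (q t).
have [px _] := tm_proj tm; have [_ hx _] := tm_near tm.
have Dxu : (mg_dist (tm_x tm) u)%:R <= K * (2 * K + M * k (q t)).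
  apply: (le_trans (tm_lower _ _)); rewrite ler_wpM2l//.
  by have := mdist_tri (tm_map (tm_x tm)) (q t) (tm_map u); lra.
have := median_lipschitz (tm_o tm) (tm_z tm) (tm_x tm) u.
have <- : u = mg_med (tm_o tm) (tm_z tm) u.
  by apply: med_unique => //; exact/btw_sym/btwxx.
rewrite med_swap -(ler_nat R) => Dpu.
have := tm_upper (mg_med (tm_o tm) (tm_x tm) (tm_z tm)) u.
have := ler_wpM2l K0 (le_trans Dpu Dxu).
have := mdist_tri (p (q t)) (tm_map (mg_med (tm_o tm) (tm_x tm) (tm_z tm))) (q t).
have := mdist_tri (tm_map (mg_med (tm_o tm) (tm_x tm) (tm_z tm))) (tm_map u) (q t).
rewrite (mdistC (p (q t)) (tm_map _)) (mdistC (tm_map u) (q t)).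
have : 0 <= K * (k (q t) - 1) by rewrite mulr_ge0 ?subr_ge0.
have : 0 <= K * (K * K) * (k (q t) - 1) by rewrite mulr_ge0 ?subr_ge0// !mulr_ge0.
lra.
Qed.

Lemma projection_lipschitz : exists2 C, 0 <= C &
  forall x y, d (p x) (p y) <= C * (d x y + 1).
Proof.
have K0' := K0; have KK : 0 <= K * K by rewrite mulr_ge0.
have KKK : 0 <= K * K * K by rewrite mulr_ge0.
exists (K * K + 3 * (K * K * K) + 3 * K); first by lra.
move=> x y; have [tm] := models x y (lexx 0).
have [px py] := tm_proj tm.
have := median_lipschitz (tm_o tm) (tm_z tm) (tm_x tm) (tm_y tm).
rewrite (med_swap _ (tm_x tm)) (med_swap _ (tm_y tm)) -(ler_nat R) => h.
have := ler_wpM2l K0 (le_trans h (tm_xy tm)).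
have := tm_upper (mg_med (tm_o tm) (tm_x tm) (tm_z tm)) (mg_med (tm_o tm) (tm_y tm) (tm_z tm)).
have := mdist_tri (p x) (tm_map (mg_med (tm_o tm) (tm_x tm) (tm_z tm))) (p y).
have := mdist_tri (tm_map (mg_med (tm_o tm) (tm_x tm) (tm_z tm)))
  (tm_map (mg_med (tm_o tm) (tm_y tm) (tm_z tm))) (p y).
rewrite (mdistC (p x) (tm_map _)).
have : 0 <= (3 * (K * K * K) + 3 * K) * d x y by rewrite mulr_ge0//; lra.
lra.
Qed.

(** Compare [x] with a point of [Z] near it, which the projection almost fixes. *)
Lemma projection_dist : exists2 C, 0 <= C & forall x, d x (p x) <= C * (dZ x + k x).
Proof.
have [C3 C30 h3] := projection_fix; have [C2 C20 h2] := projection_lipschitz.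
have k10 := sublinear_ge0 kappa_sublin (@ler01 R).
have C4 : 0 <= C3 * (2 + kappa 1) by rewrite mulr_ge0//; lra.
exists (1 + C3 * (2 + kappa 1) + 2 * C2); first by lra.
move=> x; have [_ [t /= + <-] ht] := dist_to_near x Zn0 ltr01.
rewrite in_itv/= andbT => t0.
have dx0 := dist_to_ge0 x Z; have dxo := dist_to_le x Zo.
have kq : k (q t) <= (2 + kappa 1) * k x.
  apply: (@le_trans _ _ (kappa (2 * d x o + 1))).
    apply: sublinear_mono => //.
    by have := mdist_tri (q t) x o; rewrite (mdistC (q t) x); lra.
  by apply: sublinear_affine => //; lra.
have k1 := kappa_at_ge1 o kappa_sublin x.
have := ler_wpM2l C30 kq; have := h3 t t0.
have : C2 * (d x (q t) + 1) <= C2 * (dZ x + 2) by rewrite ler_wpM2l//; lra.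
have := h2 (q t) x; rewrite (mdistC (q t) x).
have := mdist_tri x (q t) (p x); have := mdist_tri (q t) (p (q t)) (p x).
rewrite (mdistC (q t) (p (q t))).
have : 0 <= C3 * (2 + kappa 1) * dZ x by rewrite mulr_ge0.
have : 0 <= C2 * (dZ x + 2 * (k x - 1)).
  by rewrite mulr_ge0//; lra.
lra.
Qed.

(** If the gap is not bounded directly, [x] lies at distance O(d x y + kappa) from
    [Z], hence O(kappa) as d x y is a small fraction of this distance, and the
    coarse Lipschitz bound suffices. *)
Lemma projection_contracts : exists c C, [/\ 0 < c, c <= 1, 0 <= C &
  forall x y, d x y < c * dZ x -> d (p x) (p y) <= C * k x].
Proof.
have K0' := K0; have M0' := M0.
have [C1 C10 near] := projection_near; have [C2 C20 lip] := projection_lipschitz.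
have [E E0 hE] := sublinear_absorb kappa_sublin (addr_ge0 M0 ler01) (@ltr01 R).
have KK : 1 <= K * K by rewrite mulr_ege1.
pose l := 3 * (K * K); pose e := K * (K * (6 * K)) + 2 * K.
have l1 : 1 <= l by rewrite /l; lra.
have e0 : 0 <= e by rewrite /e addr_ge0// !mulr_ge0.
have ke := sublinear_ge0 kappa_sublin e0; have kE := sublinear_ge0 kappa_sublin E0.
pose Bk := l + kappa e; have Bk0 : 0 <= Bk by rewrite /Bk; lra.
pose G := K * ((M + 1) * Bk + M * ((2 + kappa E) * Bk) + K).
have G0 : 0 <= G by rewrite /G mulr_ge0// !addr_ge0// !mulr_ge0// addr_ge0.
pose C' := 3 * K + 9 * (K * K * K) + K * G + C1.
have KKK : 0 <= K * K * K by rewrite !mulr_ge0.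
have KG : 0 <= K * G by rewrite mulr_ge0.
have C'0 : 0 <= C' by rewrite /C'; lra.
have CC : 0 <= C2 * (2 * C' + 1) by rewrite mulr_ge0//; lra.
(* [model_gap] costs a factor 3, and the passage to the model and back [K * K]: the
   constant makes 3 * (K * K) * d x y at most half of the distance from [x] to [Z]. *)
exists (1 / (6 * (K * K))), (4 * (K * G) + 5 * K + C2 * (2 * C' + 1)).
have c0 : 0 < 1 / (6 * (K * K)) by rewrite divr_gt0//; lra.
have c1 : 1 / (6 * (K * K)) <= 1 by rewrite ler_pdivrMr; lra.
split=> //; first by lra.
move=> x y xy; have dZx := dist_to_le x Zo; have dZ0 := dist_to_ge0 x Z.
have xyZ : d x y <= dZ x.
  by apply: (le_trans (ltW xy)); rewrite ler_piMl.
have yo : d y o <= 2 * d x o by have := mdist_tri y x o; rewrite (mdistC y x); lra.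
pose b := l * d x o + e.
have b0 : 0 <= b by rewrite addr_ge0// mulr_ge0// (le_trans ler01).
have B0 : 0 <= 2 * b + E by rewrite addr_ge0// mulr_ge0.
have [tm] := models x y B0.
have hE' t : 0 <= t -> (M + 1) * kappa t <= t + E by move=> /hE; rewrite mul1r.
have xo0 : 0 <= d x o by [].
have small u (n : nat) : n%:R <= K * (3 * d x o + 6 * K) ->
    (mg_dist (tm_o tm) u <= n)%N -> d (tm_map u) o <= b.
  move=> nK; rewrite -(ler_nat R) => /le_trans/(_ nK)/(ler_wpM2l K0) h.
  by apply: (le_trans (tm_norm u)); rewrite /b /l /e; lra.
have smallx u : (mg_dist (tm_o tm) u <= mg_dist (tm_o tm) (tm_x tm) +
    mg_dist (tm_x tm) (tm_y tm))%N -> d (tm_map u) o <= b.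
  apply: small; rewrite natrD; have := tm_ox tm; have := tm_xy tm.
  have : K * d x y <= K * d x o by rewrite ler_wpM2l//; lra.
  have : 0 <= K * d x o by rewrite mulr_ge0.
  lra.
have smally u : (mg_dist (tm_o tm) u <= mg_dist (tm_o tm) (tm_y tm) +
    mg_dist (tm_y tm) (tm_x tm))%N -> d (tm_map u) o <= b.
  apply: small; rewrite natrD (mg_distC (tm_y tm) (tm_x tm)); have := tm_oy tm; have := tm_xy tm.
  have : K * d x y <= K * d x o by rewrite ler_wpM2l//; lra.
  have : K * d y o <= K * (2 * d x o) by rewrite ler_wpM2l.
  lra.
have := model_gap b0 hE' erefl smallx smally; rewrite /=.
set px := mg_med (tm_o tm) (tm_x tm) (tm_z tm).
set py := mg_med (tm_o tm) (tm_y tm) (tm_z tm); set c := K * _ => gap.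
have k1 := kappa_at_ge1 o kappa_sublin x.
have cG : c <= G * k x.
  have kb : kappa b <= Bk * k x by exact: sublinear_affine.
  have kB : kappa (2 * b + E) <= (2 + kappa E) * (Bk * k x).
    apply: (@le_trans _ _ ((2 + kappa E) * kappa b)).
      by apply: sublinear_affine => //; rewrite ler1n.
    by rewrite ler_wpM2l// addr_ge0.
  rewrite /c /G -mulrA ler_wpM2l//.
  have := ler_wpM2l (addr_ge0 M0 ler01) kb; have := ler_wpM2l M0 kB.
  have : 0 <= K * (k x - 1) by rewrite mulr_ge0 ?subr_ge0.
  move: (kappa b) (kappa (2 * b + E)) => kb' kB'; lra.
have [hpx hpy] := tm_proj tm; rewrite -/px -/py in hpx hpy.
have [_ hx _] := tm_near tm.
have Kc := ler_wpM2l K0 cG; clearbody px py c.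
clear hE hE' smallx smally small cG B0 b0 ke kE.
have KGk : 0 <= (K * G) * (k x - 1) by rewrite mulr_ge0 ?subr_ge0.
have Kk : 0 <= K * (k x - 1) by rewrite mulr_ge0 ?subr_ge0.
have CCk : 0 <= C2 * (2 * C' + 1) * (k x) by rewrite mulr_ge0//; exact: le_trans k1.
case: gap => [near_p|far].
  have := tm_upper px py; have := ler_wpM2l K0 near_p.
  have := mdist_tri (p x) (tm_map px) (p y); have := mdist_tri (tm_map px) (tm_map py) (p y).
  by rewrite (mdistC (p x) (tm_map px)); lra.
suff : d (p x) (p y) <= C2 * (2 * C' + 1) * k x.
  have : 0 <= (4 * (K * G) + 5 * K) * k x by rewrite mulr_ge0//; lra.
  lra.
have dZC : dZ x <= 2 * C' * k x.
  have h1 := dist_to_lip x (p x) Zn0; have h2 := near x.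
  have h3 := tm_upper px (tm_x tm).
  have h4 : K * (mg_dist px (tm_x tm))%:R <= K * (3 * (K * (d x y + 3 * K)) + c).
    by rewrite ler_wpM2l//; have := tm_xy tm; lra.
  have h5 : (K * K) * d x y <= (K * K) * (1 / (6 * (K * K)) * dZ x).
    by rewrite ler_wpM2l ?ltW//; lra.
  have h6 : (K * K) * (1 / (6 * (K * K)) * dZ x) = dZ x / 6.
    by field; rewrite gt_eqF// (lt_le_trans ltr01 K1).
  have := mdist_tri x (tm_map (tm_x tm)) (p x); have := mdist_tri (tm_map (tm_x tm)) (tm_map px) (p x).
  rewrite (mdistC x (tm_map _)) (mdistC (tm_map (tm_x tm)) (tm_map px)) => h7 h8.
  have : 0 <= (K * K * K) * (k x - 1) by rewrite mulr_ge0 ?subr_ge0.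
  rewrite /C'; lra.
apply: (le_trans (lip x y)); rewrite -mulrA ler_wpM2l//.
by rewrite mulrDl mul1r lerD// (le_trans xyZ).
Qed.

Lemma projection_contracting : kappa_contracting o kappa Z.
Proof.
have [C1 C10 near] := projection_near; have [C2 C20 dist] := projection_dist.
have [c [C3 [c0 c1 C30 con]]] := projection_contracts.
have k1 x := kappa_at_ge1 o kappa_sublin x.
have /choice[z hz] : forall x, exists z, Z z /\ d (p x) z <= (C1 + 1) * k x.
  move=> x; have [z Zz h] := dist_to_near (p x) Zn0 ltr01.
  by exists z; split=> //; have := near x; have := k1 x; lra.
exists (fun x => [set z x]), (C2 + 1), (C2 + C1 + 1), c, (C3 + 3 * (C1 + 1)); split.
- by split=> //; lra.
- by move=> x; split; [move=> _ ->; case: (hz x)|exists (z x)].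
- move=> x; apply: diam_le_mdist.
  have xz : d x (z x) <= (C2 + 1 + 1) * dZ x + (C2 + C1 + 1) * k x.
    have := mdist_tri x (p x) (z x); have := dist x; have [_] := hz x.
    by have := dist_to_ge0 x Z; lra.
  have xz0 : 0 <= (C2 + 1 + 1) * dZ x + (C2 + C1 + 1) * k x by apply: le_trans xz.
  by move=> _ _ [->|->] [->|->]; rewrite ?mdistxx// mdistC.
move=> x y xy; apply: diam_le_mdist.
have kk : k y <= 2 * k x.
  apply: (@le_trans _ _ (kappa (2 * d x o))); last by apply: sublinear_scale => //; lra.
  apply: sublinear_mono => //; have := dist_to_le x Zo; have := mdist_tri y x o.
  have : c * dZ x <= dZ x by rewrite ler_piMl// dist_to_ge0.
  by rewrite (mdistC y x); lra.
have zz : d (z x) (z y) <= (C3 + 3 * (C1 + 1)) * k x.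
  have := mdist_tri (z x) (p x) (z y); have := mdist_tri (p x) (p y) (z y).
  have [_ +] := hz x; have [_ +] := hz y; have := con x y xy; rewrite (mdistC (z x) (p x)).
  have : (C1 + 1) * k y <= (C1 + 1) * (2 * k x) by rewrite ler_wpM2l// addr_ge0.
  lra.
have zz0 : 0 <= (C3 + 3 * (C1 + 1)) * k x by apply: le_trans zz.
by move=> _ _ [->|->] [->|->]; rewrite ?mdistxx// mdistC.
Qed.

End ProjectionEstimates.

(** * The equivalence *)

Theorem theorem4 (R : realType) (X : metricType R) (o : X) (kappa : R -> R)
    (q : R -> X) :
  proper_space X -> geodesic_space (@mdist R X) -> LQC X ->
  sublinear kappa ->
  (exists a A : R, quasi_geodesic_ray o a A q) ->
  (kappa_Morse o kappa (q @` `[0, +oo[) <-> kappa_contracting o kappa (q @` `[0, +oo[)) /\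
  (kappa_contracting o kappa (q @` `[0, +oo[) <-> weakly_kappa_Morse o kappa (q @` `[0, +oo[)).
Proof.
move=> X_proper geo lqc kappa_sublin [a [A [q0 qg]]].
have Zo : (q @` `[0, +oo[) o by rewrite -q0; exact: image_ray.
have [[a1 A0] _ _] := qg.
pose N := Num.max a A; have N1 : 1 <= N by rewrite le_max a1.
have q_coarse T : coarse_path N 0 T q.
  apply: (quasi_geodesic_coarse_path qg); rewrite ?le_max ?lexx ?orbT// => v /andP[v0 _].
  by rewrite /= in_itv/= v0.
have ret_contr : Morse_for_returning_rays o kappa (q @` `[0, +oo[) ->
    kappa_contracting o kappa (q @` `[0, +oo[).
  move=> ret; have [p [K [M [K1 M1 models]]]] :=
    tracked_models kappa_sublin N1 q0 q_coarse X_proper geo lqc ret.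
  exact: (projection_contracting kappa_sublin q0 K1 M1 models).
split; split.
- by move=> h; apply: ret_contr; exact: kappa_Morse_returning.
- exact: contracting_Morse.
- exact: contracting_weakly_Morse.
- by move=> h; apply: ret_contr; exact: weakly_Morse_returning.
Qed.
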